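(* Let $M,N$ be finite-dimensional von Neumann algebras with faithful positive functionals $\varphi_M,\varphi_N$. Let $A\colon M\to N$ be completely positive, let $V\subseteq\mathcal B(L^2(M),L^2(N))$ be the quantum relation associated to $A$, and set $\theta=A^*_{KMS}\colon N\to M$, which is also completely positive. Then $V^\theta=\nabla_N^{1/4}V\nabla_M^{-1/4}$. In particular, when $\varphi_M,\varphi_N$ are traces, $V^\theta=V$.
   Context: Inner products are linear in the second variable. For a finite-dimensional von Neumann algebra $M$ with faithful positive functional $\varphi_M$, let $L^2(M)$ be the GNS space with GNS map $\Lambda=\Lambda_M\colon M\to L^2(M)$ (a linear bijection, $(\Lambda(x)|\Lambda(y))=\varphi_M(x^*y)$); $M$ acts on $L^2(M)$ by left multiplication, and $M'$ is its commutant in $\mathcal B(L^2(M))$. Linear maps $A\colon M\to N$ are identified with operators in $\mathcal B(L^2(M),L^2(N))$ via $A\Lambda_M(x)=\Lambda_N(A(x))$, and $A^*$ is the Hilbert space adjoint. The Markov trace $\mathrm{Tr}_M$ is the restriction to $M$ of the canonical trace on $\mathcal B(L^2(M))$; $Q_M\in M$ is the positive invertible element with $\varphi_M(x)=\mathrm{Tr}_M(Q_Mx)$. Put $\sigma_z(x)=Q_M^{iz}xQ_M^{-iz}$ ($z\in\mathbb C$), $J_M\Lambda(x)=\Lambda(\sigma_{-i/2}(x^* ))$, $\nabla_M\Lambda(x)=\Lambda(Q_MxQ_M^{-1})$; similarly for $N$. $M^{op}=\{x^{op}:x\in M\}$ is the opposite algebra. $\Psi'\colon\mathcal B(L^2(M),L^2(N))\to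 N\otimes M^{op}$ is the linear bijection with $\Psi'(|\Lambda(x)\rangle\langle\Lambda(y)|)=x\otimes(\sigma_{i/2}(y)^* )^{op}$, where $|\xi\rangle\langle\eta|\colon\zeta\mapsto(\eta|\zeta)\xi$. $N\otimes M^{op}$ acts on $\mathcal B(L^2(M),L^2(N))$ (Hilbert–Schmidt operators, identified with $L^2(N)\otimes\overline{L^2(M)}$) by $(a\otimes b^{op})T=aTb$, and $\mathrm{Im}(x)$ denotes the image of $x\in N\otimes M^{op}$ in this action. The quantum relation associated to $A$ is $V=\{\nabla_N^{1/4}T\nabla_M^{1/4}:T\in\mathrm{Im}\,\Psi'(A)\}$. The KMS adjoint is $A^*_{KMS}=\nabla_M^{-1/2}A^*\nabla_N^{1/2}$, which for completely positive $A$ equals $J_MA^*J_N$. For a completely positive map $\theta\colon N\to M$, choose a Hilbert space $L$ and $v\colon L^2(M)\to L^2(N)\otimes L$ bounded with $\theta(y)=v^*(y\otimes1)v$ for $y\in N$; then $V^\theta$ is the weak$^*$-closed linear span of $\{y'(1\otimes\langle\xi|)v:\xi\in L,y'\in N'\}\subseteq\mathcal B(L^2(M),L^2(N))$, where $\langle\xi|\colon\eta\mapsto(\xi|\eta)$; it is independent of the choice of $(L,v)$. *)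

(* Defs.v *)
From HB Require Import structures.
From mathcomp Require Import all_boot all_order all_algebra.
From mathcomp Require Import falgebra complex.
From mathcomp Require Import all_classical all_reals all_analysis.

Set Implicit Arguments.
Unset Strict Implicit.
Unset Printing Implicit Defensive.

Import Order.TTheory GRing.Theory Num.Theory.

Local Open Scope classical_set_scope.
Local Open Scope ring_scope.
Local Open Scope complex_scope.

(* A finite-dimensional von Neumann algebra, presented as a finite-dimensional
   C*-algebra; a norm on a finite-dimensional space is automatically
   complete. *)
HB.mixin Record isFdVNAlgebra (R : realType) M
    of Falgebra R[i] M := {
  star : M -> M;
  starD : forall x y : M, star (x + y) = star x + star y;
  starZ : forall (a : R[i]) (x : M), star (a *: x) = Num.conj a *: star x;
  starM : forall x y : M, star (x * y) = star y * star x;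
  starK : forall x : M, star (star x) = x;
  cstar_norm : exists nrm : M -> R,
    [/\ (forall x, nrm x = 0 -> x = 0) /\
        (forall x y, nrm (x + y) <= nrm x + nrm y),
        forall (a : R[i]) x, (nrm (a *: x))%:C = `|a| * (nrm x)%:C,
        forall x y, nrm (x * y) <= nrm x * nrm y &
        forall x, nrm (star x * x) = nrm x ^+ 2]
}.

#[short(type="fdVNAlgType")]
HB.structure Definition FdVNAlgebra (R : realType) :=
  { M of isFdVNAlgebra R M & Falgebra R[i] M }.

Record hilbertSpace (R : realType) := HilbertSpace {
  hilbert_sort :> lmodType R[i];
  hip : hilbert_sort -> hilbert_sort -> R[i];
  hip_linear : forall x a y z, hip x (a *: y + z) = a * hip x y + hip x z;
  hip_conj : forall x y, hip y x = Num.conj (hip x y);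
  hip_ge0 : forall x, 0 <= hip x x;
  hip_eq0 : forall x, hip x x = 0 -> x = 0;
  hip_complete : forall u : nat -> hilbert_sort,
    (forall e : R[i], 0 < e -> exists n0, forall m n,
       (n0 <= m)%N -> (n0 <= n)%N -> hip (u m - u n) (u m - u n) < e) ->
    exists l, forall e : R[i], 0 < e -> exists n0, forall n,
       (n0 <= n)%N -> hip (u n - l) (u n - l) < e
}.

(* The principal value of a^w for a > 0; only used at such a. *)
Definition cpow (R : realType) (a w : R[i]) : R[i] :=
  let t := ln (complex.Re a) in
  (expR (complex.Re w * t))%:C *
  (cos (complex.Im w * t) +i* sin (complex.Im w * t)).

(* T^w for T diagonalisable with positive spectrum (e.g. T positive invertible
   for some inner product): the operator acting as a^w on ker (T - a). *)
Definition opow (R : realType) (E : vectType R[i]) (T : 'End(E)) (w : R[i]) :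
    'End(E) :=
  xget 0 [set S : 'End(E) | forall a x, T x = a *: x -> S x = cpow a w *: x].

Definition optrace (K : fieldType) (E : vectType K) (T : 'End(E)) : K :=
  \sum_i coord (vbasis {:E}) i (T (vbasis {:E})`_i).

(* The smallest linear subspace containing S. In a finite-dimensional space
   of operators every subspace is weak*-closed, so this is also the
   weak*-closed linear span. *)
Definition lspan (K : fieldType) (E : vectType K) (S : set E) : set E :=
  [set x | forall U : {vspace E}, S `<=` [set y | y \in U] -> x \in U].

Section Algebra.
Variables (R : realType) (M : fdVNAlgType R).

Definition vn_positive (a : M) : Prop := exists b : M, a = star b * b.

(* The positive elements of the C*-algebra M_k(M). *)
Definition mx_positive k (X : 'M[M]_k) : Prop :=
  exists Y : 'M[M]_k, X = map_mx star Y^T *m Y.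

Definition markov_trace (a : M) : R[i] := optrace (amull a).

Definition commutant : set 'End(M) :=
  [set T | forall a : M, (T \o amull a = amull a \o T)%VF].

Variable phi : {scalar M}.

Definition faithful_positive : Prop :=
  (forall x : M, 0 <= phi (star x * x)) /\
  (forall x : M, phi (star x * x) = 0 -> x = 0).

Definition tracial : Prop := forall x y : M, phi (x * y) = phi (y * x).

(* L^2(M) is the vector space M with this inner product, and the GNS map is the
   identity; thus B(L^2(M), L^2(N)) is 'Hom(M, N), and the operator defined by a
   linear map M -> N is that map itself. *)
Definition gns (x y : M) : R[i] := phi (star x * y).

Definition density : M := xget 0 [set q : M |
  [/\ vn_positive q, q \is a GRing.unit &
      forall x : M, phi x = markov_trace (q * x)]].

(* Q^w as an element of M, M acting on L^2(M) by left multiplication. *)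
Definition density_pow (w : R[i]) : M :=
  xget 0 [set q : M | amull q = opow (amull density) w].

Definition modular_aut (z : R[i]) (x : M) : M :=
  density_pow ('i * z) * x * density_pow (- ('i * z)).

Definition modular_op : 'End(M) :=
  (amull density \o amulr (density^-1)%R)%VF.

Definition modular_pow (s : R) : 'End(M) := opow modular_op s%:C.

End Algebra.

Section Maps.
Variables (R : realType) (M N : fdVNAlgType R).

Definition completely_positive (A : 'Hom(M, N)) : Prop :=
  forall k (X : 'M[M]_k), mx_positive X -> mx_positive (map_mx A X).

(* N (x) M^op in coordinates, for the chosen bases of N and of M; M^op has M as
   its underlying vector space. Only the linear structure of N (x) M^op and its
   action on operators are used. *)
Definition tensor_op := 'M[R[i]]_(\dim {:N}, \dim {:M}).

(* The elementary tensor x (x) b^op *)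
Definition tens_op (x : N) (b : M) : tensor_op :=
  \matrix_(i, j) (coord (vbasis {:N}) i x * coord (vbasis {:M}) j b).

(* The linear extension of (a (x) b^op) T = a T b *)
Definition tensor_act (t : tensor_op) (T : 'Hom(M, N)) : 'Hom(M, N) :=
  \sum_i \sum_j t i j *:
    (amull (vbasis {:N})`_i \o T \o amull (vbasis {:M})`_j)%VF.

Definition tensor_im (t : tensor_op) : set 'Hom(M, N) := range (tensor_act t).

Variables (phiM : {scalar M}) (phiN : {scalar N}).

Definition op_adjoint (A : 'Hom(M, N)) : 'Hom(N, M) :=
  xget 0 [set B : 'Hom(N, M) |
    forall x y, gns phiN (A x) y = gns phiM x (B y)].

Definition kms_adjoint (A : 'Hom(M, N)) : 'Hom(N, M) :=
  (modular_pow phiM (- 2^-1) \o op_adjoint A \o modular_pow phiN 2^-1)%VF.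

(* Psi' is the linear map sending the rank one operator |x><y| to
   x (x) (sigma_{i/2}(y)^* )^op. *)
Definition psi' : 'Hom('Hom(M, N), tensor_op) :=
  xget 0 [set P : 'Hom('Hom(M, N), tensor_op) |
    forall (x : N) (y : M) (T : 'Hom(M, N)),
      (forall z, T z = gns phiM y z *: x) ->
      P T = tens_op x (star (modular_aut phiM ('i / 2) y))].

Definition quantum_relation (A : 'Hom(M, N)) : set 'Hom(M, N) :=
  [set (modular_pow phiN 4^-1 \o T \o modular_pow phiM 4^-1)%VF
    | T in tensor_im (psi' A)].

Section Dilation.
Variable L : hilbertSpace R.

(* L^2(N) (x) L: with e the chosen (not necessarily orthonormal) basis of N,
   the family t stands for the sum of the e_j (x) t_j. *)
Definition l2tensor := {ffun 'I_(\dim {:N}) -> L}.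

Definition l2tensor_ip (t u : l2tensor) : R[i] :=
  \sum_(i < \dim {:N}) \sum_(j < \dim {:N})
    gns phiN (vbasis {:N})`_i (vbasis {:N})`_j * hip (t i) (u j).

(* y (x) 1 *)
Definition l2tensor_act (y : N) (t : l2tensor) : l2tensor :=
  [ffun i => \sum_(j < \dim {:N})
     coord (vbasis {:N}) i (y * (vbasis {:N})`_j) *: t j].

(* 1 (x) <xi| *)
Definition l2tensor_slice (xi : L) (t : l2tensor) : N :=
  \sum_(j < \dim {:N}) hip xi (t j) *: (vbasis {:N})`_j.

(* theta(y) = v^* (y (x) 1) v on L^2(M). Linear maps v out of the
   finite-dimensional space L^2(M) are bounded; w is the adjoint v^*. *)
Definition is_dilation (theta : 'Hom(N, M)) (v : {linear M -> l2tensor}) :=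
  exists w : {linear l2tensor -> M},
    (forall x t, l2tensor_ip (v x) t = gns phiM x (w t)) /\
    (forall (y : N) (x : M), theta y * x = w (l2tensor_act y (v x))).

(* V^theta as computed from the dilation (L, v) *)
Definition dilation_relation (v : {linear M -> l2tensor}) : set 'Hom(M, N) :=
  lspan [set T : 'Hom(M, N) | exists2 y' : 'End(N), commutant y' &
    exists xi : L, forall x, T x = y' (l2tensor_slice xi (v x))].

End Dilation.
End Maps.

(* Main.v *)
From HB Require Import structures.
Require Import Defs.
From mathcomp Require Import all_boot all_order all_algebra.
From mathcomp Require Import falgebra complex ring.
From mathcomp Require Import all_classical all_reals all_analysis.

Set Implicit Arguments.
Unset Strict Implicit.
Unset Printing Implicit Defensive.

Import Order.TTheory GRing.Theory Num.Theory.

Local Open Scope classical_set_scope.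
Local Open Scope ring_scope.
Local Open Scope complex_scope.

(** Every operator commuting with left multiplications on [L^2(N)] is a right
    multiplication. Write [theta] for the KMS adjoint of [A] and, for [zeta] in
    [M], let [W zeta] be the adjoint of the operator [n |-> theta n * zeta]. The
    theorem holds because both relations are the linear span of the operators
    [W zeta] followed by right multiplications of [N].

    For the quantum relation, expand [A] in a Parseval frame [e] of [L^2(M)], so
    that [psi' A] is the sum of the tensors of [A e] with the modular twist of
    [star e] ([psi'_frame]). The powers of the modular operator collapse, and the
    twisted relation is the range of the linear map
    [T |-> nabla^(1/2) (psi' A . T)] ([quantum_relation_half]). As the modular
    group acts by automorphisms, this map sends the rank one operator of [eta] and
    [zeta] to [W zeta] followed by right multiplication by [nabla^(1/2) eta]
    ([nabla_half_op_rank_one]).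

    For the dilation relation, a frame of the relevant part of [L] turns the
    dilation into finitely many Kraus operators [K e], and the relation is spanned
    by the [K e] followed by right multiplications ([kraus_family]). The
    Kraus decomposition writes [W zeta] as the sum of the [K e] followed by the
    adjoints of right multiplication by [K e zeta] ([kraus_adjoint]), which gives
    one inclusion. The other one is [kraus_functional_zero]: a functional that
    vanishes on all [W zeta] followed by right multiplications also vanishes on all
    [K e] followed by right multiplications, by faithfulness of the trace.

    Complete positivity of [theta] follows from a duality between the Stinespring
    forms of [A] and [theta] ([kms_adjoint_duality]) together with square roots of
    positive operators, which stay in any algebra that is a commutant
    ([mx_positive_form]). The same square roots produce a dilation of [theta] on
    [L^2(N) (x) L^2(M)] ([dilation_exists]).

    All this rests on the concrete form of the modular theory: the density exists,
    its powers lie in the algebra, and powers of the modular operator are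
    conjugations by them ([density_exists], [modular_powE]). These facts are checked
    on eigenvectors, which span by the spectral theorem
    ([selfadjoint_eigenbasis]). *)

(** * Inner products and the spectral theorem *)
Lemma lfun_of_linear (K : fieldType) (E F : vectType K) (f : E -> F) :
  linear f -> exists S : 'Hom(E, F), forall x, S x = f x.
Proof.
move=> fL.
pose fm := GRing.isLinear.Build _ _ _ _ f fL.
pose fl : {linear E -> F} := HB.pack f fm.
by exists (linfun fl) => x; rewrite lfunE.
Qed.

Lemma linear_comb (K : pzRingType) (V W : lmodType K) (f : V -> W) (I : Type)
    (r : seq I) (a : I -> K) (x : I -> V) :
  linear f -> f (\sum_(i <- r) a i *: x i) = \sum_(i <- r) a i *: f (x i).
Proof.
move=> fL; elim: r => [|i r IH]; last by rewrite !big_cons fL IH.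
rewrite !big_nil; have := fL 1 0 0; rewrite !scale1r addr0 => e.
by apply: (addrI (f 0)); rewrite addr0 -e.
Qed.

Section InnerProducts.
Variable C : numClosedFieldType.

Record sesquilinear (V : lmodType C) (G : V -> V -> C) : Prop := Sesquilinear {
  sesq_linr : forall x a y z, G x (a *: y + z) = a * G x y + G x z;
  sesq_linl : forall x a y z, G (a *: y + z) x = Num.conj a * G y x + G z x
}.

Section SesquilinearTheory.
Variables (V : lmodType C) (G : V -> V -> C) (Gs : sesquilinear G).

Lemma sesqDr x y z : G x (y + z) = G x y + G x z.
Proof. by rewrite -{1}[y]scale1r (sesq_linr Gs) mul1r. Qed.

Lemma sesq0r x : G x 0 = 0.
Proof. by apply: (addrI (G x 0)); rewrite -sesqDr !addr0. Qed.

Lemma sesqZr x a y : G x (a *: y) = a * G x y.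
Proof. by rewrite -[a *: y]addr0 (sesq_linr Gs) sesq0r addr0. Qed.

Lemma sesqDl x y z : G (y + z) x = G y x + G z x.
Proof. by rewrite -{1}[y]scale1r (sesq_linl Gs) rmorph1 mul1r. Qed.

Lemma sesq0l x : G 0 x = 0.
Proof. by apply: (addrI (G 0 x)); rewrite -sesqDl !addr0. Qed.

Lemma sesqZl x a y : G (a *: y) x = Num.conj a * G y x.
Proof. by rewrite -[a *: y]addr0 (sesq_linl Gs) sesq0l addr0. Qed.

Lemma sesq_sumr (I : Type) (r : seq I) (F : I -> V) x :
  G x (\sum_(i <- r) F i) = \sum_(i <- r) G x (F i).
Proof. by apply: (big_morph (G x)); [exact: sesqDr | exact: sesq0r]. Qed.

Lemma sesq_suml (I : Type) (r : seq I) (F : I -> V) x :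
  G (\sum_(i <- r) F i) x = \sum_(i <- r) G (F i) x.
Proof.
by apply: (big_morph (G^~ x)); [move=> y z; exact: sesqDl | exact: sesq0l].
Qed.

End SesquilinearTheory.

(** Polarization: the diagonal values at [x + y] and at ['i x + y] determine
    [G x y] and [G y x]. *)
Lemma real_sesq_herm (V : lmodType C) (G : V -> V -> C) :
  sesquilinear G -> (forall x, Num.conj (G x x) = G x x) ->
  forall x y, G y x = Num.conj (G x y).
Proof.
move=> [linr linl] Gr x y.
have e1 := Gr (1 *: x + y).
have e2 := Gr ('i *: x + y).
move: e1 e2; rewrite !linr !linl !rmorphD !rmorphM !rmorphD !rmorphM /=.
rewrite !rmorph1 !Gr !conjCK conjCi !mul1r.
set p := G x y; set q := G y x => e1 e2.
(* 'i times the first identity plus the second isolates q. *)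
have h : ('i : C) * 2 != 0 by rewrite mulf_neq0 ?neq0Ci ?pnatr_eq0.
apply: (mulfI h); apply/eqP; rewrite eq_sym -subr_eq0.
move/eqP: e1; rewrite -subr_eq0 => /eqP e1.
move/eqP: e2; rewrite -subr_eq0 => /eqP e2.
have := congr2 +%R (congr1 ( *%R 'i) e1) e2; rewrite mulr0 addr0 => <-.
by apply/eqP; ring.
Qed.

Record inner_product (V : lmodType C) (ip : V -> V -> C) : Prop := InnerProduct {
  ip_linear : forall x a y z, ip x (a *: y + z) = a * ip x y + ip x z;
  ip_conj : forall x y, ip y x = Num.conj (ip x y);
  ip_ge0 : forall x, 0 <= ip x x;
  ip_eq0 : forall x, ip x x = 0 -> x = 0
}.

Section Theory.
Variables (V : lmodType C) (ip : V -> V -> C) (ipP : inner_product ip).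

Lemma ip_sesq : sesquilinear ip.
Proof.
split=> x a y z; first exact: (ip_linear ipP).
by rewrite ![ip _ x](ip_conj ipP) (ip_linear ipP) rmorphD rmorphM.
Qed.

Lemma ipDr x y z : ip x (y + z) = ip x y + ip x z.
Proof. exact: (sesqDr ip_sesq). Qed.

Lemma ip0r x : ip x 0 = 0.
Proof. exact: (sesq0r ip_sesq). Qed.

Lemma ipZr x a y : ip x (a *: y) = a * ip x y.
Proof. exact: (sesqZr ip_sesq). Qed.

Lemma ipBr x y z : ip x (y - z) = ip x y - ip x z.
Proof. by rewrite -scaleN1r ipDr ipZr mulN1r. Qed.

Lemma ipDl x y z : ip (y + z) x = ip y x + ip z x.
Proof. exact: (sesqDl ip_sesq). Qed.

Lemma ipZl x a y : ip (a *: y) x = Num.conj a * ip y x.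
Proof. exact: (sesqZl ip_sesq). Qed.

Lemma ip0l x : ip 0 x = 0.
Proof. exact: (sesq0l ip_sesq). Qed.

Lemma ip_sumr (I : Type) (r : seq I) (F : I -> V) x :
  ip x (\sum_(i <- r) F i) = \sum_(i <- r) ip x (F i).
Proof. exact: (sesq_sumr ip_sesq). Qed.

Lemma ip_suml (I : Type) (r : seq I) (F : I -> V) x :
  ip (\sum_(i <- r) F i) x = \sum_(i <- r) ip (F i) x.
Proof. exact: (sesq_suml ip_sesq). Qed.

Lemma ip_ext x y : (forall z, ip z x = ip z y) -> x = y.
Proof.
move=> e; apply/eqP; rewrite -subr_eq0; apply/eqP; apply: (ip_eq0 ipP).
by rewrite ipBr e subrr.
Qed.

(** A family reproducing every vector is a Parseval frame. Orthonormal bases are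
    the main example, but linear independence never matters below, and frames
    spare all bookkeeping of dimensions. *)
Definition reproducing (s : seq V) (x : V) : Prop :=
  x = \sum_(e <- s) ip e x *: e.

Lemma reproducing_ip s x y :
  reproducing s x -> ip x y = \sum_(e <- s) ip x e * ip e y.
Proof.
move=> sx; rewrite {1}sx ip_suml; apply: eq_bigr => e _.
by rewrite ipZl -(ip_conj ipP).
Qed.

Lemma reproducing_ipr s x y :
  reproducing s y -> ip x y = \sum_(e <- s) ip x e * ip e y.
Proof.
by move=> sy; rewrite {1}sy ip_sumr; apply: eq_bigr => e _; rewrite ipZr mulrC.
Qed.

(** Gram-Schmidt orthogonalization, in a space that need not be finite
    dimensional: this is what provides a frame for the part of the dilation space
    [L] that a dilation actually reaches. The elements of [s] must themselves be
    reproduced for the induction to go through: it is how their orthonormality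
    is remembered. *)
Lemma gram_schmidt (us : seq V) :
  exists s : seq V, forall u, u \in us ++ s -> reproducing s u.
Proof.
elim: us => [|u us [s sP]]; first by exists [::].
(* the component of u orthogonal to the frame built so far *)
pose r := u - \sum_(e <- s) ip e u *: e.
have [r0|r_neq0] := eqVneq r 0.
  exists s => x; rewrite inE -/cat => /orP[/eqP->|/sP//].
  by rewrite /reproducing; apply/eqP; rewrite -subr_eq0; exact/eqP.
have er e : e \in us ++ s -> ip e r = 0.
  move=> /sP se; rewrite ipBr ip_sumr (reproducing_ip _ se).
  by apply/eqP; rewrite subr_eq0; apply/eqP/eq_bigr => f _; rewrite ipZr mulrC.
have rr0 : ip r r != 0 by apply: contra_neq r_neq0; exact: (ip_eq0 ipP).
pose n := sqrtC (ip r r).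
have n0 : n != 0 by rewrite sqrtC_eq0.
have nJ : Num.conj n = n.
  by apply/CrealP; apply: ger0_real; rewrite sqrtC_ge0 (ip_ge0 ipP).
have nn : ip r r = n * n by rewrite -expr2 sqrtCK.
pose f := n^-1 *: r.
have fe e : e \in us ++ s -> ip f e = 0.
  by move=> /er re; rewrite (ip_conj ipP) ipZr re mulr0 rmorph0.
exists (f :: s) => x; rewrite mem_cat !inE /reproducing big_cons.
have old y : y \in us ++ s -> y = ip f y *: f + \sum_(e <- s) ip e y *: e.
  by move=> ys; rewrite fe // scale0r add0r; exact: sP.
case/orP=> [/orP[/eqP->|xu]|/orP[/eqP->|xs]]; try by
  apply: old; rewrite mem_cat ?xu ?xs ?orbT.
  have -> : ip f u = n.
    have -> : u = r + \sum_(e <- s) ip e u *: e by rewrite subrK.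
    rewrite ipDr ip_sumr big_seq big1 ?addr0 => [|e es]; last first.
      by rewrite ipZr fe ?mulr0 // mem_cat es orbT.
    by rewrite ipZl nn fmorphV /= nJ mulKf.
  by rewrite scalerA divff // scale1r subrK.
have -> : ip f f = 1.
  by rewrite ipZr ipZl fmorphV /= nJ nn mulKf // mulVf.
rewrite scale1r big_seq big1 ?addr0 // => e es.
by rewrite ipZr er ?mulr0 ?scale0r // mem_cat es orbT.
Qed.

End Theory.

Lemma finite_frame (E : vectType C) (ip : E -> E -> C) :
  inner_product ip -> exists s : seq E, forall x, reproducing ip s x.
Proof.
move=> ipP; have [s sP] := gram_schmidt ipP (vbasis {:E}).
exists s => x; rewrite /reproducing.
rewrite [in LHS](coord_vbasis (memvf x)).
rewrite (eq_bigr (fun i => \sum_(e <- s)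
   coord (vbasis {:E}) i x *: (ip e (vbasis {:E})`_i *: e))) => [|i _]; last first.
  by rewrite -scaler_sumr; congr (_ *: _); apply: sP; rewrite mem_cat mem_nth ?size_tuple.
rewrite exchange_big; apply: eq_bigr => e _ /=.
rewrite [x in ip e x](coord_vbasis (memvf x)) (ip_sumr ipP) scaler_suml.
by apply: eq_bigr => i _; rewrite (ipZr ipP) scalerA.
Qed.

Section FiniteDim.
Variables (E : vectType C) (ip : E -> E -> C) (ipP : inner_product ip).

Lemma riesz (f : E -> C) :
  scalar f -> exists g, forall x, f x = ip g x.
Proof.
move=> fL; have [s sP] := finite_frame ipP.
pose fm := GRing.isLinear.Build _ _ _ _ f fL.
pose fl : {scalar E} := HB.pack f fm.
exists (\sum_(e <- s) Num.conj (f e) *: e) => x.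
rewrite (ip_suml ipP) -[f]/(fl : E -> C) [x in LHS]sP linear_sum.
by apply: eq_bigr => e _; rewrite linearZ (ipZl ipP) /= conjCK mulrC.
Qed.

(** A sesquilinear form is the form of an operator; the frame gives its values. *)
Lemma sesq_operator (G : E -> E -> C) :
  sesquilinear G -> exists T : 'End(E), forall x y, G x y = ip x (T y).
Proof.
move=> Gs; have [s sP] := finite_frame ipP.
have [|T TE] := @lfun_of_linear _ E E (fun y => \sum_(e <- s) G e y *: e).
  move=> a x y; rewrite scaler_sumr -big_split; apply: eq_bigr => e _ /=.
  by rewrite (sesq_linr Gs) scalerDl scalerA.
exists T => x y; rewrite TE (ip_sumr ipP) {1}(sP x) (sesq_suml Gs).
by apply: eq_bigr => e _; rewrite (sesqZl Gs) (ipZr ipP) -(ip_conj ipP) mulrC.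
Qed.

Lemma adjoint_exists (F : vectType C) (ipF : F -> F -> C) (T : 'Hom(E, F)) :
  inner_product ipF ->
  exists S : 'Hom(F, E), forall x y, ipF (T x) y = ip x (S y).
Proof.
move=> ipFP; have [s sP] := finite_frame ipP.
have [|S SE] := @lfun_of_linear _ F E (fun y => \sum_(e <- s) ipF (T e) y *: e).
  move=> a x y; rewrite scaler_sumr -big_split; apply: eq_bigr => e _ /=.
  by rewrite (ip_linear ipFP) scalerDl scalerA.
exists S => x y; rewrite SE (ip_sumr ipP) [x in LHS]sP linear_sum (ip_suml ipFP).
apply: eq_bigr => e _.
by rewrite linearZ (ipZl ipFP) (ipZr ipP) -(ip_conj ipP) mulrC.
Qed.

Definition has_eigenbasis (F : vectType C) (T : 'End(F)) : Prop :=
  exists n (X : n.-tuple F) (a : 'I_n -> C),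
    basis_of fullv X /\ forall i : 'I_n, T X`_i = a i *: X`_i.

(** An eigenvector of the matrix of the restriction to [U], whose existence is
    due to the algebraic closedness of [C]. *)
Lemma eigenvector_exists (F : vectType C) (T : 'End(F)) (U : {vspace F}) :
  (forall x, x \in U -> T x \in U) -> (0 < \dim U)%N ->
  exists x a, [/\ x \in U, x != 0 & T x = a *: x].
Proof.
move=> TU U0; pose X := vbasis U.
pose B : 'M[C]_(\dim U) := \matrix_(i, j) coord X j (T X`_i).
have [a /eigenvalueP[v vB v0]] := eigenvalue_closed B U0.
exists (\sum_i v 0 i *: X`_i), a; split.
- by apply: memv_suml => i _; rewrite memvZ // vbasis_mem // mem_nth ?size_tuple.
- apply: contra_neq v0 => e; apply/rowP => i; rewrite mxE.
  have /freeP/(_ (fun i => v 0 i) e i)// := basis_free (vbasisP U).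
rewrite linear_sum scaler_sumr.
transitivity (\sum_i \sum_j (v 0 i * B i j) *: X`_j).
  apply: eq_bigr => i _; rewrite linearZ /=.
  have Ti : T X`_i \in U by apply: TU; rewrite vbasis_mem // mem_nth ?size_tuple.
  rewrite {1}(coord_vbasis Ti) scaler_sumr; apply: eq_bigr => j _.
  by rewrite scalerA mxE.
rewrite exchange_big; apply: eq_bigr => j _ /=.
rewrite -scaler_suml scalerA; congr (_ *: _).
by have := congr1 (fun w : 'rV_ _ => w 0 j) vB; rewrite !mxE.
Qed.

Definition selfadjoint (T : 'End(E)) : Prop :=
  forall x y, ip (T x) y = ip x (T y).

(** The spectral theorem: split off an eigenvector; its orthogonal complement is
    invariant because [T] is self-adjoint. *)
Lemma selfadjoint_eigenbasis (T : 'End(E)) : selfadjoint T -> has_eigenbasis T.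
Proof.
move=> Ts.
suff [s [/andP[sU fs] sP]] : exists s : seq E, basis_of fullv s /\
    forall x, x \in s -> exists a, T x = a *: x.
  have {}sP (i : 'I_(size s)) : exists a, T s`_i = a *: s`_i.
    by apply: sP; rewrite mem_nth.
  have [a aP] := choice sP.
  by exists (size s), (in_tuple s), a; split=> //; apply/andP.
suff H n : forall U : {vspace E}, \dim U = n -> (forall x, x \in U -> T x \in U) ->
    exists s : seq E, basis_of U s /\ forall x, x \in s -> exists a, T x = a *: x.
  by apply: (H _ fullv erefl) => x _; exact: memvf.
elim: n => [|n IH] U dU TU.
  exists [::]; split=> //.
  by rewrite /basis_of span_nil nil_free andbT eq_sym -dimv_eq0 dU.
have [|x [a [xU x0 Tx]]] := eigenvector_exists TU; first by rewrite dU.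
have [|fx fxE] := @lfun_of_linear _ E C^o (ip x); first exact: (ip_linear ipP).
pose W := (U :&: lker fx)%VS.
have memW y : (y \in W) = (y \in U) && (ip x y == 0).
  by rewrite memv_cap memv_ker fxE.
have xx0 : ip x x != 0 by apply: contra_neq x0; exact: (ip_eq0 ipP).
have xW : x \notin W by rewrite memW (negPf xx0) andbF.
have UE : U = (<[x]> + W)%VS.
  apply/eqP; rewrite eqEsubv; apply/andP; split.
    apply/subvP => y yU; apply/memv_addP.
    exists ((ip x y / ip x x) *: x); first by rewrite memvZ // memv_line.
    exists (y - (ip x y / ip x x) *: x); last by rewrite addrC subrK.
    rewrite memW rpredB ?memvZ //=.
    by rewrite (ipBr ipP) (ipZr ipP) divfK // subrr.
  by rewrite subv_add -memvE xU capvSl.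
have dW : \dim W = n.
  have := dU; rewrite UE dimv_disjoint_sum; last first.
    apply/eqP; rewrite -subv0; apply/subvP => y; rewrite memv_cap => /andP[/vlineP[k ->]].
    by rewrite rpredZeq (negPf xW) orbF => /eqP->; rewrite scale0r mem0v.
  by rewrite dim_vline x0 add1n => -[].
have [|s [sW sP]] := IH W dW.
  move=> y; rewrite !memW => /andP[yU /eqP xy].
  by rewrite TU //= -Ts Tx (ipZl ipP) xy mulr0.
exists (x :: s); split; last first.
  by move=> y; rewrite inE => /orP[/eqP->|/sP//]; exists a.
have [/eqP spW fs] := andP sW.
by rewrite /basis_of span_cons spW free_cons fs spW xW /= -UE eqxx.
Qed.

End FiniteDim.
End InnerProducts.

(** * Functional calculus and square roots *)
Section FunctionalCalculus.
Variable C : numClosedFieldType.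

(** Eigenvectors span, so identities between operators built from [T] need only be
    checked on eigenvectors of [T]. Nearly every identity about powers is proved
    in this way. *)
Lemma eigen_ext (E F : vectType C) (T : 'End(E)) (S S' : 'Hom(E, F)) :
  has_eigenbasis T -> (forall a x, T x = a *: x -> S x = S' x) -> S = S'.
Proof.
move=> [n [X [a [XB TX]]]] e; apply/lfunP => x.
rewrite (coord_basis XB (memvf x)) !linear_sum.
by apply: eq_bigr => i _; rewrite !linearZ /= (e _ _ (TX i)).
Qed.

(** The operator [f(T)] is defined on an eigenbasis. An arbitrary eigenvector for
    the eigenvalue [a] only has components along basis vectors with that same
    eigenvalue, hence the claim for all eigenvectors. *)
Lemma calculus_exists (E : vectType C) (T : 'End(E)) (f : C -> C) :
  has_eigenbasis T ->
  exists S : 'End(E), forall a x, T x = a *: x -> S x = f a *: x.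
Proof.
move=> [n [X [a [XB TX]]]].
have [|S SE] := @lfun_of_linear _ E E
    (fun x => \sum_i (f (a i) * coord X i x) *: X`_i).
  move=> k x y; rewrite scaler_sumr -big_split; apply: eq_bigr => i _ /=.
  by rewrite linearP mulrDr scalerDl scalerA mulrCA.
exists S => b x Tx; rewrite SE [in RHS](coord_basis XB (memvf x)) scaler_sumr.
apply: eq_bigr => i _; rewrite scalerA.
suff : (a i - b) * coord X i x = 0.
  move/eqP; rewrite mulf_eq0 => /orP[|/eqP->]; last by rewrite !mulr0 scale0r.
  by rewrite subr_eq0 => /eqP->.
rewrite mulrBl; apply/eqP; rewrite subr_eq0; apply/eqP.
have := congr1 (coord X i) Tx; rewrite linearZ /= => <-.
rewrite [x in T x](coord_basis XB (memvf x)) linear_sum linear_sum.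
rewrite (bigD1 i) //= big1 ?addr0 => [|j ji].
  rewrite linearZ /= TX linearZ linearZ /= coord_free ?(basis_free XB) //.
  by rewrite eqxx mulr1 mulrC.
rewrite linearZ /= TX linearZ linearZ /= coord_free ?(basis_free XB) //.
by rewrite (_ : (j == i) = false) ?mulr0 //; apply: negbTE.
Qed.

Section WithInnerProduct.
Variables (E : vectType C) (ip : E -> E -> C) (ipP : inner_product ip).

(** Eigenvectors for different eigenvalues are orthogonal, and on a common
    eigenspace [S] acts by the real number [f a]. *)
Lemma selfadjoint_calculus (T S : 'End(E)) (f : C -> C) :
  selfadjoint ip T ->
  (forall a x, T x = a *: x -> S x = f a *: x) ->
  (forall a x, T x = a *: x -> x != 0 -> Num.conj (f a) = f a) ->
  selfadjoint ip S.
Proof.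
move=> Ts Sf fr x y; have Td := selfadjoint_eigenbasis ipP Ts.
have evr a z : T z = a *: z -> z != 0 -> Num.conj a = a.
  move=> Tz z0; have zz : ip z z != 0 by apply: contra_neq z0; exact: (ip_eq0 ipP).
  by apply: (mulIf zz); rewrite -(ipZl ipP) -(ipZr ipP) -Tz Ts.
suff key : forall b z, T z = b *: z -> forall w, ip z (S w) = ip (S z) w.
  have [Sa SaP] := adjoint_exists ipP S ipP.
  suff e : Sa = S by rewrite SaP e.
  apply: (eigen_ext Td) => b z Tz; apply: (ip_ext ipP) => w.
  by rewrite -SaP (ip_conj ipP) (key _ _ Tz) -(ip_conj ipP).
move=> b z Tz w; have [->|z0] := eqVneq z 0; first by rewrite linear0 !(ip0l ipP).
have [|g gE] := @lfun_of_linear _ E C^o (ip z); first exact: (ip_linear ipP).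
suff -> : ip z (S w) = ((f b) *: g) w.
  by rewrite scale_lfunE gE (Sf _ _ Tz) (ipZl ipP) (fr _ _ Tz z0).
suff <- : (g \o S = f b *: g)%VF by rewrite comp_lfunE gE.
apply: (eigen_ext Td) => a v Tv; rewrite comp_lfunE scale_lfunE !gE (Sf _ _ Tv).
rewrite (ipZr ipP); have [->|ab] := eqVneq a b; first by [].
suff -> : ip z v = 0 by rewrite mulr0 scaler0.
have : (a - b) * ip z v = 0.
  rewrite mulrBl -(ipZr ipP) -Tv -(evr _ _ Tz z0) -(ipZl ipP) -Tz -Ts.
  by rewrite subrr.
by move/eqP; rewrite mulf_eq0 subr_eq0 (negPf ab) /= => /eqP.
Qed.

Lemma ip_operator_sesq (T : 'End(E)) : sesquilinear (fun x y => ip x (T y)).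
Proof.
split=> x a y z; first by rewrite linearP (ip_linear ipP).
by rewrite (ipDl ipP) (ipZl ipP).
Qed.

Lemma positive_selfadjoint (T : 'End(E)) :
  (forall x, 0 <= ip x (T x)) -> selfadjoint ip T.
Proof.
move=> T0 x y; rewrite (ip_conj ipP).
rewrite (real_sesq_herm (ip_operator_sesq T)) ?conjCK // => z.
exact/CrealP/ger0_real.
Qed.

Lemma positive_eigenvalue (T : 'End(E)) a x :
  (forall x, 0 <= ip x (T x)) -> T x = a *: x -> x != 0 -> 0 <= a.
Proof.
move=> T0 Tx x0; have := T0 x; rewrite Tx (ipZr ipP).
suff xx : 0 < ip x x by rewrite pmulr_lge0.
rewrite lt0r (ip_ge0 ipP) andbT.
by apply: contra_neq x0; exact: (ip_eq0 ipP).
Qed.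

(** The square root commutes with whatever commutes with [T]. This is how a square
    root taken among all operators of a GNS space is seen to lie in the algebra
    acting on it, and how the dilation below becomes a module map. *)
Lemma positive_sqrt (T : 'End(E)) :
  (forall x, 0 <= ip x (T x)) ->
  exists S : 'End(E), [/\ selfadjoint ip S, (S \o S)%VF = T &
    forall U : 'End(E), (U \o T = T \o U)%VF -> (U \o S = S \o U)%VF].
Proof.
move=> T0; have Ts := positive_selfadjoint T0.
have Td := selfadjoint_eigenbasis ipP Ts.
have [S Sf] := calculus_exists sqrtC Td.
exists S; split.
- apply: (selfadjoint_calculus Ts Sf) => a x Tx x0.
  by apply/CrealP/ger0_real; rewrite sqrtC_ge0 (positive_eigenvalue T0 Tx).
- apply: (eigen_ext Td) => a x Tx.
  by rewrite comp_lfunE (Sf _ _ Tx) linearZ /= (Sf _ _ Tx) scalerA -expr2 sqrtCK.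
move=> U UT; apply: (eigen_ext Td) => a x Tx.
rewrite !comp_lfunE (Sf _ _ Tx) linearZ /=; apply/esym/Sf.
by rewrite -[T (U x)]comp_lfunE -UT comp_lfunE Tx linearZ.
Qed.

End WithInnerProduct.
End FunctionalCalculus.

(** * Real powers of operators with positive spectrum *)
Section OperatorPowers.
Variables (R : realType) (E : vectType R[i]).
Local Notation C := R[i].

Definition positive_spectrum (T : 'End(E)) : Prop :=
  has_eigenbasis T /\ forall a x, T x = a *: x -> x != 0 -> 0 < a.

Lemma positive_definite_spectrum (ip : E -> E -> C) (T : 'End(E)) :
  inner_product ip -> (forall x, x != 0 -> 0 < ip x (T x)) ->
  selfadjoint ip T /\ positive_spectrum T.
Proof.
move=> ipP T0.
have T0' x : 0 <= ip x (T x).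
  by have [->|/T0/ltW//] := eqVneq x 0; rewrite (ip0l ipP).
have Ts := positive_selfadjoint ipP T0'.
split=> //; split; first exact: selfadjoint_eigenbasis Ts.
move=> a x Tx x0; rewrite lt0r (positive_eigenvalue ipP T0' Tx x0) andbT.
have := T0 x x0; rewrite Tx (ipZr ipP).
by apply: contraTneq => ->; rewrite mul0r ltxx.
Qed.

Lemma cpow_real (a : C) (s : R) :
  cpow a s%:C = (expR (s * ln (complex.Re a)))%:C.
Proof. by rewrite /cpow /= mul0r cos0 sin0 [1 +i* 0]/(1%:C) mulr1. Qed.

Lemma cpowD (a : C) (s t : R) : cpow a (s + t)%:C = cpow a s%:C * cpow a t%:C.
Proof. by rewrite !cpow_real mulrDl expRD rmorphM. Qed.

Lemma cpow0 (a : C) : cpow a 0%:C = 1.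
Proof. by rewrite cpow_real mul0r expR0. Qed.

Lemma gt0_Re (a : C) : 0 < a -> a = (complex.Re a)%:C /\ 0 < complex.Re a.
Proof.
by case: a => x y; rewrite ltcE /= => /andP[/eqP-> x0].
Qed.

Lemma cpow1 (a : C) : 0 < a -> cpow a 1%:C = a.
Proof.
move=> /gt0_Re[aE a0]; rewrite cpow_real mul1r lnK ?posrE //.
Qed.

Lemma cpowM (a b : C) (s : R) : 0 < a -> 0 < b ->
  cpow (a * b) s%:C = cpow a s%:C * cpow b s%:C.
Proof.
move=> /gt0_Re[-> a0] /gt0_Re[-> b0].
by rewrite -rmorphM !cpow_real /= lnM ?posrE // mulrDr expRD rmorphM.
Qed.

Lemma cpow_conj (a : C) (s : R) : Num.conj (cpow a s%:C) = cpow a s%:C.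
Proof. by rewrite cpow_real; apply/CrealP; rewrite complex_real. Qed.

Section Powers.
Variable T : 'End(E).

Lemma opow_eigen w a x : has_eigenbasis T -> T x = a *: x ->
  opow T w x = cpow a w *: x.
Proof.
move=> Td; have := xgetPex 0 (P := [set S : 'End(E) | forall a x, T x = a *: x ->
  S x = cpow a w *: x]) (calculus_exists (fun b => cpow b w) Td).
exact.
Qed.

Lemma opow_unique w (S : 'End(E)) : has_eigenbasis T ->
  (forall a x, T x = a *: x -> S x = cpow a w *: x) -> opow T w = S.
Proof.
by move=> Td e; apply: (eigen_ext Td) => a x Tx; rewrite (opow_eigen _ Td Tx) (e _ _ Tx).
Qed.

Lemma opowD s t : has_eigenbasis T ->
  opow T (s + t)%:C = (opow T s%:C \o opow T t%:C)%VF.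
Proof.
move=> Td; apply: opow_unique => // a x Tx.
by rewrite comp_lfunE (opow_eigen _ Td Tx) linearZ /= (opow_eigen _ Td Tx) scalerA
  cpowD mulrC.
Qed.

Lemma opow0 : has_eigenbasis T -> opow T 0%:C = \1%VF.
Proof.
by move=> Td; apply: opow_unique => // a x Tx; rewrite cpow0 scale1r id_lfunE.
Qed.

Lemma opow1 : positive_spectrum T -> opow T 1%:C = T.
Proof.
move=> [Td T0]; apply: opow_unique => // a x Tx; rewrite Tx.
have [->|x0] := eqVneq x 0; first by rewrite !scaler0.
by rewrite cpow1 // (T0 _ _ Tx).
Qed.

Lemma opow_comm w (U : 'End(E)) : has_eigenbasis T ->
  (U \o T = T \o U)%VF -> (U \o opow T w = opow T w \o U)%VF.
Proof.
move=> Td UT; apply: (eigen_ext Td) => a x Tx.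
rewrite !comp_lfunE (opow_eigen _ Td Tx) linearZ /=; apply/esym/opow_eigen => //.
by rewrite -[T (U x)]comp_lfunE -UT comp_lfunE Tx linearZ.
Qed.

Lemma opow_selfadjoint (ip : E -> E -> C) s :
  inner_product ip -> selfadjoint ip T -> selfadjoint ip (opow T s%:C).
Proof.
move=> ipP Ts; have Td := selfadjoint_eigenbasis ipP Ts.
apply: (selfadjoint_calculus (f := fun b => cpow b s%:C) ipP Ts) => a x Tx.
  exact: opow_eigen.
by move=> _; exact: cpow_conj.
Qed.

End Powers.
End OperatorPowers.

(** * Traces of operators *)
Section Trace.
Variables (K : fieldType) (E : vectType K).

Lemma optrace_linear (T S : 'End(E)) (a : K) :
  optrace (a *: T + S) = a * optrace T + optrace S.
Proof.
rewrite /optrace mulr_sumr -big_split; apply: eq_bigr => i _ /=.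
by rewrite add_lfunE scale_lfunE linearP.
Qed.

Lemma optraceC (T S : 'End(E)) : optrace (T \o S)%VF = optrace (S \o T)%VF.
Proof.
pose X := vbasis {:E}.
have H (U V : 'End(E)) : optrace (U \o V)%VF =
    \sum_(i < \dim {:E}) \sum_(j < \dim {:E}) coord X j (V X`_i) * coord X i (U X`_j).
  apply: eq_bigr => i _; rewrite comp_lfunE.
  rewrite {1}[V _](coord_vbasis (memvf _)) linear_sum linear_sum.
  by apply: eq_bigr => j _; rewrite linearZ /= linearZ.
rewrite !H exchange_big; apply: eq_bigr => i _; apply: eq_bigr => j _ /=.
by rewrite mulrC.
Qed.

End Trace.

(** The trace may be computed in any frame. *)
Lemma optrace_frame (C : numClosedFieldType) (E : vectType C)
    (ip : E -> E -> C) (s : seq E) (T : 'End(E)) :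
  inner_product ip -> (forall x, reproducing ip s x) ->
  optrace T = \sum_(e <- s) ip e (T e).
Proof.
move=> ipP sP; pose X := vbasis {:E}.
transitivity (\sum_(i < \dim {:E}) \sum_(e <- s) ip e X`_i * coord X i (T e)).
  apply: eq_bigr => i _; rewrite {1}(sP (X`_i)) linear_sum linear_sum.
  by apply: eq_bigr => e _; rewrite linearZ /= linearZ.
rewrite exchange_big; apply: eq_bigr => e _ /=.
rewrite [T e in RHS](coord_vbasis (memvf _)) (ip_sumr ipP).
by apply: eq_bigr => i _; rewrite (ipZr ipP) mulrC.
Qed.

(** * The Markov trace, the density and the modular operator *)
Section StarAlgebra.
Variables (R : realType) (M : fdVNAlgType R).
Implicit Types x y : M.

Lemma star1 : star (1 : M) = 1.
Proof. by have := starM (star (1 : M)) 1; rewrite mulr1 starK mulr1 => <-. Qed.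

Lemma star0 : star (0 : M) = 0.
Proof. by have := starZ 0 (0 : M); rewrite rmorph0 !scale0r. Qed.

Lemma star_sum (I : Type) (r : seq I) (F : I -> M) :
  star (\sum_(i <- r) F i) = \sum_(i <- r) star (F i).
Proof. by apply: (big_morph (@star R M)); [exact: starD | exact: star0]. Qed.

Lemma amullE x y : amull x y = x * y.
Proof. by rewrite lfunE. Qed.

Lemma amulrE x y : amulr x y = y * x.
Proof. by rewrite lfunE. Qed.

Lemma amull_comp x y : amull (x * y) = (amull x \o amull y)%VF.
Proof. by apply/lfunP => z; rewrite comp_lfunE !amullE mulrA. Qed.

Variable phi : {scalar M}.
Hypothesis phiP : faithful_positive phi.

Lemma gns_sesq : sesquilinear (gns phi).
Proof.
split=> x a y z; rewrite /gns.
  by rewrite mulrDr -scalerAr linearP.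
by rewrite starD starZ mulrDl -scalerAl linearP.
Qed.

(** Hermitian symmetry comes for free from positivity, by polarization. *)
Lemma gns_ip : inner_product (gns phi).
Proof.
have [phi0 phi_eq0] := phiP; have [linr linl] := gns_sesq.
split=> //; apply: real_sesq_herm; first exact: gns_sesq.
by move=> x; apply/CrealP/ger0_real/phi0.
Qed.

Lemma gns_mull x y z : gns phi (x * y) z = gns phi y (star x * z).
Proof. by rewrite /gns starM mulrA. Qed.

Local Notation tr := (@markov_trace R M).

Lemma tr_linear (a : R[i]) x y : tr (a *: x + y) = a * tr x + tr y.
Proof. by rewrite /markov_trace linearP optrace_linear. Qed.

Lemma tr0 : tr 0 = 0.
Proof. by rewrite -[0](addNr 0) -scaleN1r tr_linear mulN1r addNr. Qed.

Lemma tr_sum (I : Type) (r : seq I) (F : I -> M) :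
  tr (\sum_(i <- r) F i) = \sum_(i <- r) tr (F i).
Proof.
apply: (big_morph tr); last exact: tr0.
by move=> x y; rewrite -{1}[x]scale1r tr_linear mul1r.
Qed.

Lemma trC x y : tr (x * y) = tr (y * x).
Proof. by rewrite /markov_trace !amull_comp optraceC. Qed.

Lemma tr_frame s x : (forall y, reproducing (gns phi) s y) ->
  tr x = \sum_(e <- s) gns phi e (x * e).
Proof.
move=> sP; rewrite /markov_trace (optrace_frame _ gns_ip sP).
by apply: eq_bigr => e _; rewrite amullE.
Qed.

Definition tr_form x y : R[i] := tr (star x * y).

(** In a frame of the GNS space, the trace of [star x * x] is the sum of the
    squared norms of the vectors [x e], which vanishes only if [x] kills the frame
    and thus kills [1]. *)
Lemma tr_ip : inner_product tr_form.
Proof.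
have [s sP] := finite_frame gns_ip.
have E x : tr_form x x = \sum_(e <- s) gns phi (x * e) (x * e).
  rewrite /tr_form (tr_frame _ sP); apply: eq_bigr => e _.
  by rewrite gns_mull mulrA.
have ge0 x : 0 <= tr_form x x.
  by rewrite E; apply: sumr_ge0 => e _; exact: (ip_ge0 gns_ip).
have sq : sesquilinear tr_form.
  split=> x a y z; rewrite /tr_form; first by rewrite mulrDr -scalerAr tr_linear.
  by rewrite starD starZ mulrDl -scalerAl tr_linear.
split=> //; first by case: sq.
  by apply: (real_sesq_herm sq) => x; apply/CrealP/ger0_real.
move=> x /eqP; rewrite E psumr_eq0 => [/allP z|e _]; last exact: (ip_ge0 gns_ip).
rewrite -[x]mulr1 (sP 1) mulr_sumr big_seq big1 // => e /z /eqP xe.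
by rewrite -scalerAr (ip_eq0 gns_ip xe) scaler0.
Qed.

Lemma tr_star x : tr (star x) = Num.conj (tr x).
Proof.
by have := ip_conj tr_ip 1 x; rewrite /tr_form star1 mul1r mulr1.
Qed.

Lemma tr_riesz (f : M -> R[i]) : scalar f -> exists h, forall x, f x = tr (h * x).
Proof. by move=> /(riesz tr_ip)[g gE]; exists (star g). Qed.

Lemma tr_nondeg x y : (forall z, tr (x * z) = tr (y * z)) -> x = y.
Proof.
move=> e; apply: (can_inj (@starK R M)); apply: (ip_ext tr_ip) => z.
by rewrite /tr_form -!starM !tr_star e.
Qed.

(** The commutant of the right multiplications: it consists of the left
    multiplications, so any operator commuting with [amulr] comes from [M]. *)
Definition right_module_map (T : 'End(M)) : Prop :=
  forall y, (amulr y \o T = T \o amulr y)%VF.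

Lemma right_module_mapE (T : 'End(M)) : right_module_map T -> T = amull (T 1).
Proof.
move=> Tr; apply/lfunP => y; rewrite amullE -amulrE.
by have := congr1 (fun S : 'End(M) => S 1) (Tr y);
   rewrite !comp_lfunE [amulr y 1]amulrE mul1r.
Qed.

Lemma right_module_map_amull x : right_module_map (amull x).
Proof. by move=> y; apply/lfunP => z; rewrite !comp_lfunE !amullE !amulrE mulrA. Qed.

Lemma right_module_map_opow x w : has_eigenbasis (amull x) ->
  right_module_map (opow (amull x) w).
Proof. by move=> xd y; apply: opow_comm => //; exact: right_module_map_amull. Qed.

(** For the trace inner product, the form of left multiplication by [q] at [x] is
    [phi (x * star x)]. *)
Lemma density_spectrum q : (forall x, phi x = tr (q * x)) ->
  selfadjoint tr_form (amull q) /\ positive_spectrum (amull q).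
Proof.
move=> qE; apply: (positive_definite_spectrum tr_ip) => x x0.
rewrite /tr_form amullE trC -mulrA -qE -{1}[x]starK lt0r phiP.1 andbT.
by apply: contra_neq x0 => /phiP.2 e; rewrite -[x]starK e star0.
Qed.

(** The trace form represents [phi] by some [q]. The powers of left multiplication
    by [q] commute with right multiplications, hence are left multiplications:
    this yields the square root and the inverse of [q] inside [M]. *)
Lemma density_exists : exists q : M,
  [/\ vn_positive q, q \is a GRing.unit & forall x, phi x = tr (q * x)].
Proof.
have [|q qE] := tr_riesz (f := phi); first by move=> a x y; rewrite linearP.
have [qs qp] := density_spectrum qE.
have powE s := right_module_mapE (right_module_map_opow s%:C qp.1).
have pow_mul s t : opow (amull q) s%:C 1 * opow (amull q) t%:C 1 = opow (amull q) (s + t)%:C 1.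
  by rewrite -amullE -powE opowD ?comp_lfunE //; exact: qp.1.
have pow1 : opow (amull q) 1%:C 1 = q by rewrite opow1 // amullE mulr1.
have pow0 : opow (amull q) 0%:C 1 = 1 by rewrite opow0 ?id_lfunE //; exact: qp.1.
exists q; split=> //.
  exists (opow (amull q) (2^-1)%:C 1).
  have -> : star (opow (amull q) (2^-1)%:C 1) = opow (amull q) (2^-1)%:C 1.
    apply: (ip_ext tr_ip) => z.
    have := opow_selfadjoint (2^-1) tr_ip qs z 1.
    rewrite {1}powE amullE /tr_form starM mulr1 => <-.
    by rewrite trC.
  by rewrite pow_mul -[2^-1]mul1r -splitr.
apply/unitrP; exists (opow (amull q) (-1)%:C 1).
by rewrite -{2 3}pow1 !pow_mul addNr subrr pow0.
Qed.


Local Notation q := (density phi).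

Lemma densityP :
  [/\ vn_positive q, q \is a GRing.unit & forall x, phi x = tr (q * x)].
Proof. exact: (xgetPex 0 density_exists). Qed.

Lemma phiE x : phi x = tr (q * x).
Proof. by have [_ _] := densityP; apply. Qed.

Lemma density_unit : q \is a GRing.unit.
Proof. by have [] := densityP. Qed.

Definition dpow (s : R) : M := density_pow phi s%:C.

Lemma dpow_opow s : amull (dpow s) = opow (amull q) s%:C.
Proof.
have [_ [qd _]] := density_spectrum phiE.
apply: (xgetPex 0 (P := [set p : M | amull p = opow (amull q) s%:C])).
exists (opow (amull q) s%:C 1); apply/esym/right_module_mapE.
exact: right_module_map_opow.
Qed.

Lemma dpowD s t : dpow s * dpow t = dpow (s + t).
Proof.
have [_ [qd _]] := density_spectrum phiE.
by apply: amull_inj; rewrite amull_comp !dpow_opow (opowD s t qd).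
Qed.

Lemma dpow0 : dpow 0 = 1.
Proof.
have [_ [qd _]] := density_spectrum phiE.
by apply: amull_inj; rewrite dpow_opow opow0 // amull1.
Qed.

Lemma dpow1 : dpow 1 = q.
Proof.
have [_ qp] := density_spectrum phiE.
by apply: amull_inj; rewrite dpow_opow opow1.
Qed.

Lemma dpow_star s : star (dpow s) = dpow s.
Proof.
have [qs _] := density_spectrum phiE.
apply: (ip_ext tr_ip) => z; have := opow_selfadjoint s tr_ip qs z 1.
by rewrite -dpow_opow !amullE /tr_form starM !mulr1 => <-.
Qed.

Lemma density_inv : q^-1 = dpow (-1).
Proof.
by apply: (mulrI density_unit); rewrite divrr ?density_unit // -{1}dpow1 dpowD subrr dpow0.
Qed.

Lemma modular_opE x : modular_op phi x = q * x * q^-1.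
Proof. by rewrite comp_lfunE amullE amulrE mulrA. Qed.

Lemma modular_spectrum :
  selfadjoint (gns phi) (modular_op phi) /\ positive_spectrum (modular_op phi).
Proof.
apply: (positive_definite_spectrum gns_ip) => x x0.
have -> : gns phi x (modular_op phi x) = phi (star (star x) * star x).
  rewrite /gns modular_opE !phiE starK trC !mulrA mulrVK ?density_unit //.
  by rewrite -[_ * q * x]mulrA trC.
rewrite lt0r phiP.1 andbT.
by apply: contra_neq x0 => /phiP.2 e; rewrite -[x]starK e star0.
Qed.

Lemma modular_pow_selfadjoint s : selfadjoint (gns phi) (modular_pow phi s).
Proof. by apply: opow_selfadjoint; [exact: gns_ip | case: modular_spectrum]. Qed.

(** If [q y = c y q], then left multiplication by [y] sends eigenvectors of [q] for
    [a] to eigenvectors for [c a]; comparing powers gives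
    [q^s y = c^s y q^s], that is, conjugation by [q^s] scales [y] by [c^s]. *)
Lemma modular_powE s x : modular_pow phi s x = dpow s * x * dpow (- s).
Proof.
have [_ [md mp]] := modular_spectrum; have [_ [qd qp]] := density_spectrum phiE.
rewrite /modular_pow (@opow_unique _ _ _ _ (amulr (dpow (- s)) \o amull (dpow s))%VF) //.
  by rewrite comp_lfunE amullE amulrE.
move=> c y my; rewrite comp_lfunE amullE amulrE.
have [->|y0] := eqVneq y 0; first by rewrite mulr0 mul0r scaler0.
have c0 := mp _ _ my y0.
suff e : dpow s * y = cpow c s%:C *: (y * dpow s).
  by rewrite e -scalerAl -mulrA dpowD subrr dpow0 mulr1.
(* the eigenvalue equation of the modular operator, as a commutation rule *)
have qy z : q * (y * z) = c *: (y * (q * z)).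
  by rewrite scalerAl -my modular_opE !mulrA mulrVK // density_unit.
apply: amull_inj; rewrite linearZ /= !amull_comp; apply: (eigen_ext qd) => a z qz.
rewrite scale_lfunE !comp_lfunE dpow_opow (opow_eigen _ qd qz) linearZ /= !amullE.
have [->|yz0] := eqVneq (y * z) 0; first by rewrite linear0 !scaler0.
have z0 : z != 0 by apply: contraNneq yz0 => ->; rewrite mulr0.
have a0 := qp _ _ qz z0; rewrite scalerA -cpowM //.
apply: opow_eigen => //; rewrite amullE qy -amullE qz.
by rewrite -scalerAr scalerA.
Qed.

Lemma modular_powD s t x :
  modular_pow phi s (modular_pow phi t x) = modular_pow phi (s + t) x.
Proof.
rewrite !modular_powE opprD -(dpowD s t) [- s - t]addrC -(dpowD (- t) (- s)).
by rewrite !mulrA.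
Qed.

Lemma modular_pow0 x : modular_pow phi 0 x = x.
Proof. by rewrite modular_powE oppr0 dpow0 mul1r mulr1. Qed.

Lemma modular_powM s x y :
  modular_pow phi s (x * y) = modular_pow phi s x * modular_pow phi s y.
Proof.
have dK z : dpow (- s) * (dpow s * z) = z by rewrite mulrA dpowD addNr dpow0 mul1r.
by rewrite !modular_powE -!mulrA dK.
Qed.

Lemma modular_pow_star s x :
  star (modular_pow phi s x) = modular_pow phi (- s) (star x).
Proof. by rewrite !modular_powE !starM !dpow_star mulrA (opprK s). Qed.

(** The KMS condition: it replaces the trace property for [phi]. *)
Lemma phi_modular x y : phi (x * modular_pow phi 1 y) = phi (y * x).
Proof.
rewrite modular_powE !phiE dpow1 -density_inv trC -!mulrA.
by rewrite mulVr ?density_unit // mulr1 trC -mulrA.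
Qed.

Lemma modular_autE y :
  modular_aut phi ('i / 2) y = modular_pow phi (- 2^-1) y.
Proof.
have -> : modular_aut phi ('i / 2) y = dpow (- 2^-1) * y * dpow 2^-1; last first.
  by rewrite modular_powE opprK.
have e : 'i * ('i / 2) = (- 2^-1)%:C :> R[i].
  by rewrite mulrA -expr2 sqrCi mulN1r rmorphN fmorphV rmorph_nat.
by rewrite /modular_aut e -rmorphN /= opprK.
Qed.

Lemma tracial_modular_pow s : tracial phi -> modular_pow phi s = \1%VF.
Proof.
move=> tra; have [_ [md _]] := modular_spectrum.
have qC x : q * x = x * q.
  by apply: tr_nondeg => y; rewrite -mulrA -phiE tra phiE mulrA trC mulrA.
have m1 : modular_op phi = \1%VF.
  by apply/lfunP => x; rewrite modular_opE id_lfunE qC mulrK // density_unit.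
apply: opow_unique => // a x; rewrite m1 id_lfunE => xa.
have [->|x0] := eqVneq x 0; first by rewrite scaler0.
suff -> : a = 1 by rewrite cpow_real ln1 mulr0 expR0 scale1r.
apply/eqP; rewrite eq_sym -subr_eq0; have /eqP := xa.
by rewrite -{1}[x]scale1r -subr_eq0 -scalerBl scaler_eq0 (negPf x0) orbF.
Qed.

End StarAlgebra.

(** * Completeness of finite-dimensional inner product spaces *)
Section Completeness.
Import numFieldNormedType.Exports.
Variable R : realType.
Local Notation C := R[i].

Lemma real_cauchy_limit (u : nat -> R) :
  (forall e : R, 0 < e -> exists n0, forall m n, (n0 <= m)%N -> (n0 <= n)%N ->
     `|u m - u n| < e) ->
  exists l, forall e : R, 0 < e -> exists n0, forall n, (n0 <= n)%N -> `|u n - l| < e.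
Proof.
move=> uC; have /cauchy_cvgP/cvg_ex[l ul] : cauchy (u @ \oo).
  apply: cauchy_exP => e /uC[n0 n0P]; exists (u n0).
  by exists n0 => // n hn; rewrite /= -ball_normE /=; exact: n0P.
exists l => e e0; have /cvgrPdist_lt/(_ e e0)[n0 _ n0P] := ul.
by exists n0 => n n0n; rewrite distrC; exact: n0P.
Qed.

Lemma complex_cauchy_limit (u : nat -> C) :
  (forall e : C, 0 < e -> exists n0, forall m n, (n0 <= m)%N -> (n0 <= n)%N ->
     `|u m - u n| ^+ 2 < e) ->
  exists l, forall e : C, 0 < e -> exists n0, forall n, (n0 <= n)%N ->
     `|u n - l| ^+ 2 < e.
Proof.
move=> uC.
have sq (z : C) : `|z| ^+ 2 = (complex.Re z ^+ 2 + complex.Im z ^+ 2)%:C.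
  by rewrite -add_Re2_Im2.
have cau (f : C -> R) : (forall z w, f (z - w) = f z - f w) ->
    (forall z, (f z ^+ 2)%:C <= `|z| ^+ 2) ->
    exists l, forall e, 0 < e -> exists n0, forall n, (n0 <= n)%N -> `|f (u n) - l| < e.
  move=> fB fle; apply: real_cauchy_limit => e e0.
  have [|n0 n0P] := uC ((e ^+ 2)%:C); first by rewrite ltcR exprn_gt0.
  exists n0 => m n hm hn; have := le_lt_trans (fle _) (n0P m n hm hn).
  by rewrite ltcR fB -[X in X < _]real_normK ?num_real // ltr_pXn2r // nnegrE
    ?normr_ge0 // ltW.
have [||a aP] := cau (@complex.Re R).
- by move=> z w; rewrite raddfB.
- by move=> z; rewrite sq lecR lerDl sqr_ge0.
have [||b bP] := cau (@complex.Im R).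
- by move=> z w; rewrite raddfB.
- by move=> z; rewrite sq lecR lerDr sqr_ge0.
exists (a +i* b) => e /gt0_Re[-> e0]; set r := complex.Re e in e0 *.
have s0 : 0 < Num.sqrt (r / 2) by rewrite sqrtr_gt0 divr_gt0.
have [n1 n1P] := aP _ s0; have [n2 n2P] := bP _ s0.
exists (maxn n1 n2) => n; rewrite geq_max => /andP[/n1P h1 /n2P h2].
rewrite sq ltcR [r]splitr; case: (u n) h1 h2 => x y /= h1 h2.
have hs : Num.sqrt (r / 2) ^+ 2 = r / 2 by rewrite sqr_sqrtr // divr_ge0 // ltW.
by apply: ltrD; rewrite -hs -[X in X < _]real_normK ?num_real // ltr_pXn2r //
  nnegrE ?normr_ge0 ?ltW.
Qed.

Variables (E : vectType C) (ip : E -> E -> C) (ipP : inner_product ip).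

Lemma frame_norm (s : seq E) x : reproducing ip s x ->
  ip x x = \sum_(e <- s) `|ip e x| ^+ 2.
Proof.
move=> sx; rewrite (reproducing_ip ipP _ sx); apply: eq_bigr => e _.
by rewrite (ip_conj ipP) mulrC -normCK.
Qed.

(** The synthesis map of a Parseval frame is a contraction: with [x] the
    synthesized vector, the squared distance from [d] to the coefficients of [x]
    is the difference of the two sides. *)
Lemma synthesis_norm (s : seq E) (d : E -> C) :
  (forall x, reproducing ip s x) ->
  ip (\sum_(e <- s) d e *: e) (\sum_(e <- s) d e *: e) <= \sum_(e <- s) `|d e| ^+ 2.
Proof.
move=> sP; set x := \sum_(e <- s) _.
have e1 : ip x x = \sum_(e <- s) Num.conj (d e) * ip e x.
  by rewrite {1}/x (ip_suml ipP); apply: eq_bigr => e _; rewrite (ipZl ipP).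
have e2 : ip x x = \sum_(e <- s) d e * Num.conj (ip e x).
  rewrite (ip_conj ipP) e1 rmorph_sum; apply: eq_bigr => e _.
  by rewrite rmorphM /= conjCK.
rewrite -subr_ge0.
suff <- : \sum_(e <- s) `|d e - ip e x| ^+ 2 =
    \sum_(e <- s) `|d e| ^+ 2 - ip x x.
  by apply: sumr_ge0 => e _; rewrite exprn_ge0.
transitivity (\sum_(e <- s) (`|d e| ^+ 2 - Num.conj (d e) * ip e x
    - d e * Num.conj (ip e x) + `|ip e x| ^+ 2)).
  by apply: eq_bigr => e _; rewrite !normCK rmorphB /=; ring.
by rewrite big_split -frame_norm // !sumrB -e1 -e2 /= subrK.
Qed.

Lemma finite_dim_complete (u : nat -> E) :
  (forall e : C, 0 < e -> exists n0, forall m n,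
     (n0 <= m)%N -> (n0 <= n)%N -> ip (u m - u n) (u m - u n) < e) ->
  exists l, forall e : C, 0 < e -> exists n0, forall n,
     (n0 <= n)%N -> ip (u n - l) (u n - l) < e.
Proof.
move=> uC; have [s sP] := finite_frame ipP.
have [l lP] : exists l : E -> C, forall f, f \in s ->
    forall e : C, 0 < e -> exists n0, forall n, (n0 <= n)%N ->
    `|ip f (u n) - l f| ^+ 2 < e.
  have : forall f, exists lf : C, f \in s -> forall e : C, 0 < e ->
      exists n0, forall n, (n0 <= n)%N -> `|ip f (u n) - lf| ^+ 2 < e.
    move=> f; have [fs|] := boolP (f \in s); last by exists 0.
    have [|lf lfP] := @complex_cauchy_limit (fun n => ip f (u n)); last by exists lf.
    move=> e /uC[n0 n0P]; exists n0 => m n hm hn.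
    apply: le_lt_trans (n0P m n hm hn); rewrite -(ipBr ipP) (frame_norm (sP _)).
    rewrite (big_rem _ fs) /= lerDl; apply: sumr_ge0 => g _.
    by rewrite exprn_ge0.
  by move=> /choice[l lP]; exists l.
exists (\sum_(f <- s) l f *: f) => e e0.
have [n0 n0P] : exists n0, forall n, (n0 <= n)%N ->
    \sum_(f <- s) `|ip f (u n) - l f| ^+ 2 < e.
  elim: s lP {sP} e e0 => [|f s IH] lP e e0; first by exists 0%N => n _; rewrite big_nil.
  have e2 : 0 < e / 2 by rewrite divr_gt0 // ltr0n.
  have [n1 n1P] := lP f (mem_head _ _) _ e2.
  have [g gs|n2 n2P] := IH _ _ e2; first by apply: lP; rewrite inE gs orbT.
  exists (maxn n1 n2) => n; rewrite geq_max => /andP[/n1P h1 /n2P h2].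
  by rewrite big_cons [e]splitr ltrD.
exists n0 => n /n0P; apply: le_lt_trans.
have -> : u n - \sum_(f <- s) l f *: f = \sum_(f <- s) (ip f (u n) - l f) *: f.
  rewrite {1}(sP (u n)) -sumrB; apply: eq_bigr => f _; by rewrite scalerBl.
exact: (synthesis_norm (fun f => ip f (u n) - l f) sP).
Qed.

End Completeness.

(** * Complete positivity in the GNS space *)
Section CompletePositivity.
Variables (R : realType) (M N : fdVNAlgType R).
Variables (phiM : {scalar M}) (phiM_fp : faithful_positive phiM).

(** Positivity of the form sending [(n (x) m, n' (x) m')] to
    [(m | B (star n * n') m')]: this is complete positivity as it enters the
    Stinespring construction. *)
Definition form_positive (B : 'Hom(N, M)) : Prop :=
  forall n (x : 'I_n -> N) (m : 'I_n -> M),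
    0 <= \sum_i \sum_j gns phiM (m i) (B (star (x i) * x j) * m j).

Lemma gram_mx_entry (L : fdVNAlgType R) k (Y : 'M[L]_k) i j :
  (map_mx star Y^T *m Y) i j = \sum_c star (Y c i) * Y c j.
Proof. by rewrite mxE; apply: eq_bigr => c _; rewrite !mxE. Qed.

(** The matrix with entries [star (x i) * x j] is positive, and a Gram matrix of
    [B (star (x i) * x j)] turns the form into a sum of squared norms. *)
Lemma cp_form_positive (B : 'Hom(N, M)) :
  completely_positive B -> form_positive B.
Proof.
move=> Bcp [|n] x m; first by rewrite big_ord0.
(* a square Gram factor: first row x, the other rows zero *)
pose Y : 'M[N]_n.+1 := \matrix_(c, j) if c == ord0 then x j else 0.
have [Z ZE] := Bcp _ (map_mx star Y^T *m Y) (ex_intro _ Y erefl).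
have BE i j : B (star (x i) * x j) = \sum_c star (Z c i) * Z c j.
  rewrite -gram_mx_entry -ZE mxE gram_mx_entry; congr (B _).
  rewrite (bigD1 ord0) //= big1 ?addr0 => [|c c0]; first by rewrite !mxE.
  by rewrite !mxE (negPf c0) mulr0.
suff -> : \sum_i \sum_j gns phiM (m i) (B (star (x i) * x j) * m j) =
    \sum_c gns phiM (\sum_i Z c i * m i) (\sum_i Z c i * m i).
  by apply: sumr_ge0 => c _; exact: (ip_ge0 (gns_ip phiM_fp)).
under eq_bigr => i _ do under eq_bigr => j _ do
  rewrite BE mulr_suml (ip_sumr (gns_ip phiM_fp)).
under [RHS]eq_bigr => c _ do rewrite (ip_suml (gns_ip phiM_fp)).
rewrite [RHS]exchange_big; apply: eq_bigr => i _ /=.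
rewrite exchange_big; apply: eq_bigr => c _ /=.
rewrite (ip_sumr (gns_ip phiM_fp)); apply: eq_bigr => j _.
by rewrite gns_mull mulrA.
Qed.

Section MatrixSquareRoot.
Variable k : nat.

Definition col_ip (t u : {ffun 'I_k -> M}) : R[i] := \sum_i gns phiM (t i) (u i).

Lemma col_ipP : inner_product col_ip.
Proof.
have gP := gns_ip phiM_fp; split.
- move=> x a y z; rewrite mulr_sumr -big_split; apply: eq_bigr => i _ /=.
  by rewrite !ffunE (ip_linear gP).
- move=> x y; rewrite rmorph_sum; apply: eq_bigr => i _.
  by rewrite (ip_conj gP).
- by move=> x; apply: sumr_ge0 => i _; exact: (ip_ge0 gP).
move=> x /eqP; rewrite psumr_eq0 => [/allP z|i _]; last exact: (ip_ge0 gP).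
by apply/ffunP => i; rewrite ffunE; apply: (ip_eq0 gP); apply/eqP/z; rewrite mem_index_enum.
Qed.

Definition mx_act (X : 'M[M]_k) (t : {ffun 'I_k -> M}) : {ffun 'I_k -> M} :=
  [ffun i => \sum_j X i j * t j].

Definition col_unit (j : 'I_k) (m : M) : {ffun 'I_k -> M} :=
  [ffun i => if i == j then m else 0].

Lemma col_decomp (t : {ffun 'I_k -> M}) : t = \sum_j col_unit j (t j).
Proof.
apply/ffunP => i; rewrite sum_ffunE (bigD1 i) //= big1 ?addr0 => [|j ji].
  by rewrite ffunE eqxx.
by rewrite ffunE eq_sym (negPf ji).
Qed.

Lemma mx_act_unit X i j m : mx_act X (col_unit j m) i = X i j * m.
Proof.
rewrite ffunE (bigD1 j) //= big1 ?addr0 => [|l lj]; rewrite ffunE ?eqxx //.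
by rewrite (negPf lj) mulr0.
Qed.

Lemma col_ip_unit t j m : col_ip t (col_unit j m) = gns phiM (t j) m.
Proof.
rewrite /col_ip (bigD1 j) //= big1 ?addr0 => [|l lj]; rewrite ffunE ?eqxx //.
by rewrite (negPf lj) (ip0r (gns_ip phiM_fp)).
Qed.

(** The matrix acts as a positive operator on column vectors, commuting with right
    multiplications. So does its square root, which is therefore again the action
    of a matrix over [M]. *)
Lemma mx_positive_form (X : 'M[M]_k) :
  (forall t, 0 <= col_ip t (mx_act X t)) -> mx_positive X.
Proof.
move=> X0.
have [|T TE] := @lfun_of_linear _ _ _ (mx_act X).
  move=> a t u; apply/ffunP => i; rewrite !ffunE scaler_sumr -big_split.
  by apply: eq_bigr => j _; rewrite !ffunE mulrDr scalerAr.
have T0 t : 0 <= col_ip t (T t) by rewrite TE.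
have [S [Ss SS SC]] := positive_sqrt col_ipP T0.
pose Z : 'M[M]_k := \matrix_(i, j) S (col_unit j 1) i.
have SZ j m : S (col_unit j m) = [ffun i => Z i j * m].
  (* the square root commutes with right multiplication by m on columns *)
  have [|U UE] := @lfun_of_linear _ _ _ (fun t : {ffun 'I_k -> M} => [ffun i => t i * m]).
    by move=> a t u; apply/ffunP => i; rewrite !ffunE mulrDl scalerAl.
  have UT : (U \o T = T \o U)%VF.
    apply/lfunP => t; rewrite !comp_lfunE !TE !UE; apply/ffunP => i; rewrite !ffunE.
    by rewrite mulr_suml; apply: eq_bigr => l _; rewrite ffunE mulrA.
  have Uj : U (col_unit j 1) = col_unit j m.
    by rewrite UE; apply/ffunP => i; rewrite !ffunE; case: ifP; rewrite ?mul1r ?mul0r.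
  rewrite -Uj -[S (U _)]comp_lfunE -(SC _ UT) comp_lfunE UE.
  by apply/ffunP => i; rewrite !ffunE mxE.
(* pairing with m in place of 1 recovers elements from the functional phiM *)
have Zs i j : Z i j = star (Z j i).
  apply: (ip_ext (gns_ip phiM_fp)) => m.
  have gP := gns_ip phiM_fp; have := Ss (col_unit j 1) (col_unit i m).
  rewrite col_ip_unit (ip_conj col_ipP) !SZ col_ip_unit !ffunE mulr1 -(ip_conj gP).
  rewrite [gns _ m _](ip_conj gP) => ->; rewrite [RHS](ip_conj gP).
  by rewrite /gns starK star1 mul1r.
exists Z; apply/matrixP => i j; rewrite gram_mx_entry.
rewrite -[X i j]mulr1 -mx_act_unit -TE -SS comp_lfunE SZ.
rewrite [X in S X]col_decomp linear_sum sum_ffunE; apply: eq_bigr => c _.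
by rewrite /= SZ !ffunE mulr1 Zs.
Qed.

End MatrixSquareRoot.

Lemma form_positive_cp (B : 'Hom(N, M)) :
  form_positive B -> completely_positive B.
Proof.
move=> B0 k X [Y ->]; apply: mx_positive_form => t.
suff -> : col_ip t (mx_act (map_mx B (map_mx star Y^T *m Y)) t) =
    \sum_c \sum_i \sum_j gns phiM (t i) (B (star (Y c i) * Y c j) * t j).
  by apply: sumr_ge0 => c _; exact: B0.
rewrite exchange_big; apply: eq_bigr => i _ /=.
rewrite ffunE (ip_sumr (gns_ip phiM_fp)) exchange_big; apply: eq_bigr => j _ /=.
rewrite mxE gram_mx_entry linear_sum mulr_suml (ip_sumr (gns_ip phiM_fp)).
by [].
Qed.

End CompletePositivity.

(** * The KMS adjoint *)
Section KMSAdjoint.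
Variables (R : realType) (M N : fdVNAlgType R).
Variables (phiM : {scalar M}) (phiN : {scalar N}).
Hypotheses (phiM_fp : faithful_positive phiM) (phiN_fp : faithful_positive phiN).
Variable A : 'Hom(M, N).

Lemma op_adjointP x y :
  gns phiN (A x) y = gns phiM x (op_adjoint phiM phiN A y).
Proof.
have := xgetPex 0 (P := [set B : 'Hom(N, M) |
    forall x y, gns phiN (A x) y = gns phiM x (B y)]).
by apply; apply: (adjoint_exists (gns_ip phiM_fp)); exact: gns_ip.
Qed.

Lemma kms_adjointE y : kms_adjoint phiM phiN A y =
  modular_pow phiM (- 2^-1) (op_adjoint phiM phiN A (modular_pow phiN 2^-1 y)).
Proof. by rewrite !comp_lfunE. Qed.

Lemma gns_kms_adjoint m y : gns phiM m (kms_adjoint phiM phiN A y) =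
  gns phiN (A (modular_pow phiM (- 2^-1) m)) (modular_pow phiN 2^-1 y).
Proof. by rewrite kms_adjointE -modular_pow_selfadjoint // -op_adjointP. Qed.

(** Up to modular twists of the arguments, the form of the KMS adjoint is the
    conjugate of the form of [A], with the two tensor factors exchanged. The right
    factor [m'] and the factor [n'] are moved across with the KMS condition. *)
Lemma kms_adjoint_duality m m' n n' :
  gns phiM m (kms_adjoint phiM phiN A (star n * n') * m') =
  Num.conj (gns phiN (modular_pow phiN 2^-1 (star n))
    (A (star (modular_pow phiM 2^-1 (star m)) * modular_pow phiM 2^-1 (star m'))
     * modular_pow phiN 2^-1 (star n'))).
Proof.
rewrite -(gns_ip phiN_fp).(ip_conj) [in RHS]/gns starM (modular_pow_star phiN_fp) starK.
(* move m' to the other side of the inner product *)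
have -> : gns phiM m (kms_adjoint phiM phiN A (star n * n') * m') =
    gns phiM (m * modular_pow phiM 1 (star m')) (kms_adjoint phiM phiN A (star n * n')).
  rewrite /gns starM (modular_pow_star phiM_fp) starK -[in RHS]mulrA.
  by rewrite -[RHS](phi_modular phiM_fp) (modular_powD phiM_fp) subrr modular_pow0 // mulrA.
rewrite gns_kms_adjoint !modular_powM // (modular_powD phiM_fp).
rewrite (modular_pow_star phiM_fp) starK.
have -> : - 2^-1 + 1 = 2^-1 :> R by rewrite [X in _ + X]splitr mul1r addKr.
have -> : modular_pow phiN 2^-1 n' = modular_pow phiN 1 (modular_pow phiN (- 2^-1) n').
  by rewrite (modular_powD phiN_fp) [X in X - _]splitr mul1r addrK.
by rewrite /gns mulrA phi_modular // mulrA.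
Qed.

(** The duality matches the matrix sums for [A] and its KMS adjoint term by term,
    whence the complete positivity of the latter. *)
Lemma kms_adjoint_form_positive :
  completely_positive A -> form_positive phiM (kms_adjoint phiM phiN A).
Proof.
move=> /(cp_form_positive phiN_fp) A0 k x m.
rewrite -conjC_ge0 rmorph_sum; under eq_bigr => i _ do rewrite rmorph_sum.
under eq_bigr => i _ do under eq_bigr => j _ do
  rewrite kms_adjoint_duality /= conjCK.
exact: (A0 k (fun i => modular_pow phiM 2^-1 (star (m i)))
  (fun i => modular_pow phiN 2^-1 (star (x i)))).
Qed.

End KMSAdjoint.

(** * Sesquilinear forms on a tensor product and Stinespring dilations *)
Section TensorForms.
Variables (R : realType) (N : fdVNAlgType R) (V : lmodType R[i]).
Local Notation C := R[i].
Local Notation d := (\dim {:N}).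
Local Notation b := (vbasis {:N}).
Local Notation E := {ffun 'I_d -> V}.

Definition tensor (n : N) (m : V) : E := [ffun i => coord b i n *: m].

Definition tensor_mull (y : N) (t : E) : E :=
  [ffun i => \sum_(j < d) coord b i (y * b`_j) *: t j].

Lemma tensor_decomp (t : E) : t = \sum_(j < d) tensor b`_j (t j).
Proof.
apply/ffunP => i; rewrite sum_ffunE (bigD1 i) //= big1 ?addr0 => [|j ji].
  by rewrite ffunE coord_free ?(basis_free (vbasisP _)) // eqxx scale1r.
by rewrite ffunE coord_free ?(basis_free (vbasisP _)) // (negPf ji) scale0r.
Qed.

Lemma tensor_mull_tensor y n m : tensor_mull y (tensor n m) = tensor (y * n) m.
Proof.
apply/ffunP => i; rewrite !ffunE.
rewrite [n in RHS](coord_vbasis (memvf _)) mulr_sumr linear_sum scaler_suml.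
apply: eq_bigr => j _; rewrite ffunE scalerA -scalerAr linearZ /=.
by rewrite mulrC.
Qed.

Lemma tensor_mull_linear y : linear (tensor_mull y).
Proof.
move=> a t u; apply/ffunP => i; rewrite !ffunE scaler_sumr -big_split.
by apply: eq_bigr => j _; rewrite !ffunE scalerDr !scalerA mulrC.
Qed.

Lemma tensor_mull_sum y t : tensor_mull y t = \sum_(j < d) tensor (y * b`_j) (t j).
Proof.
by apply/ffunP => i; rewrite sum_ffunE ffunE; apply: eq_bigr => j _; rewrite ffunE.
Qed.

(** On elementary tensors this is [F (star n * n') m m']; the inner product of
    [L^2(N) (x) V] and the Stinespring form of a map are both of this shape, and so
    share the invariance under left multiplications. *)
Definition tensor_form (F : N -> V -> V -> C) (t u : E) : C :=
  \sum_(i < d) \sum_(j < d) F (star b`_i * b`_j) (t i) (u j).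

Variable F : N -> V -> V -> C.
Hypothesis F_lin : forall m m', scalar (fun n => F n m m').
Hypothesis F_sesq : forall n, sesquilinear (F n).

Lemma tensor_form_sesq : sesquilinear (tensor_form F).
Proof.
split=> t a u w; rewrite mulr_sumr -big_split; apply: eq_bigr => i _ /=;
  rewrite mulr_sumr -big_split; apply: eq_bigr => j _ /=; rewrite !ffunE.
  by rewrite (sesq_linr (F_sesq _)).
by rewrite (sesq_linl (F_sesq _)).
Qed.

Lemma tensor_kernel_comb (I : Type) (r : seq I) (f : I -> N) (a : I -> C) m m' :
  F (\sum_(i <- r) a i *: f i) m m' = \sum_(i <- r) a i * F (f i) m m'.
Proof. exact: (linear_comb (W := C^o) r a f (F_lin m m')). Qed.

Lemma tensor_form_tensor n n' m m' :
  tensor_form F (tensor n m) (tensor n' m') = F (star n * n') m m'.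
Proof.
transitivity (F (\sum_(i < d) Num.conj (coord b i n) *:
   (\sum_(j < d) coord b j n' *: (star b`_i * b`_j))) m m'); last first.
  congr (F _ m m'); rewrite [n in RHS](coord_vbasis (memvf _)) star_sum mulr_suml.
  apply: eq_bigr => i _; rewrite starZ -scalerAl; congr (_ *: _).
  rewrite [n' in RHS](coord_vbasis (memvf _)) mulr_sumr.
  by apply: eq_bigr => j _; rewrite scalerAr.
rewrite tensor_kernel_comb; apply: eq_bigr => i _; rewrite tensor_kernel_comb mulr_sumr.
by apply: eq_bigr => j _; rewrite !ffunE (sesqZr (F_sesq _)) (sesqZl (F_sesq _)) mulrCA.
Qed.

Lemma tensor_form_mull y t u :
  tensor_form F (tensor_mull y t) u = tensor_form F t (tensor_mull (star y) u).
Proof.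
have S := tensor_form_sesq.
rewrite !tensor_mull_sum {1}[u]tensor_decomp {2}[t]tensor_decomp.
rewrite !(sesq_suml S); apply: eq_bigr => i _; rewrite !(sesq_sumr S).
by apply: eq_bigr => j _; rewrite !tensor_form_tensor starM mulrA.
Qed.

End TensorForms.

(** In a frame of [N] the form is a sum of squared norms of components, and the
    components determine the tensor. *)
Lemma tensor_inner_product (R : realType) (N : fdVNAlgType R) (phiN : {scalar N})
    (V : lmodType R[i]) (ip : V -> V -> R[i]) :
  faithful_positive phiN -> inner_product ip ->
  inner_product (tensor_form (fun (n : N) m m' => phiN n * ip m m')).
Proof.
move=> phiN_fp ipP; set G := tensor_form _; pose b := vbasis {:N}.
have gP := gns_ip phiN_fp; have [s sP] := finite_frame gP.
have Gs : sesquilinear G.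
  apply: tensor_form_sesq => n; split=> x a y z.
    by rewrite (ip_linear ipP) mulrDr mulrCA.
  by rewrite (ipDl ipP) (ipZl ipP) mulrDr mulrCA.
pose comp e (t : {ffun 'I_(\dim {:N}) -> V}) := \sum_(j < \dim {:N}) gns phiN e b`_j *: t j.
have GE t : G t t = \sum_(e <- s) ip (comp e t) (comp e t).
  under [RHS]eq_bigr => e _ do rewrite (ip_suml ipP).
  rewrite [RHS]exchange_big; apply: eq_bigr => i _ /=.
  under [RHS]eq_bigr => e _ do rewrite (ip_sumr ipP).
  rewrite [RHS]exchange_big; apply: eq_bigr => j _ /=.
  rewrite -[phiN _]/(gns phiN b`_i b`_j) (reproducing_ip gP _ (sP _)) mulr_suml.
  apply: eq_bigr => e _; rewrite (ipZl ipP) (ipZr ipP) -(ip_conj gP).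
  by rewrite mulrA.
have G0 t : 0 <= G t t.
  by rewrite GE; apply: sumr_ge0 => e _; exact: (ip_ge0 ipP).
split=> //; first by case: Gs.
  by apply: (real_sesq_herm Gs) => t; apply/CrealP/ger0_real.
move=> t /eqP; rewrite GE psumr_eq0 => [/allP z|e _]; last exact: (ip_ge0 ipP).
apply/ffunP => i; rewrite ffunE.
have e1 : \sum_(e <- s) coord b i e *: comp e t = 0.
  rewrite big_seq big1 // => e /z /eqP e0.
  by rewrite (ip_eq0 ipP e0) scaler0.
rewrite -[RHS]e1; under [RHS]eq_bigr => e _ do rewrite scaler_sumr.
rewrite exchange_big /= [in LHS](tensor_decomp t) sum_ffunE; apply: eq_bigr => j _.
rewrite ffunE; under [RHS]eq_bigr => e _ do rewrite scalerA.
rewrite -scaler_suml; congr (_ *: _); rewrite {1}(sP b`_j) linear_sum.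
by apply: eq_bigr => e _; rewrite linearZ /= mulrC.
Qed.

Section Dilations.
Variables (R : realType) (M N : fdVNAlgType R).
Variables (phiM : {scalar M}) (phiN : {scalar N}).
Hypotheses (phiM_fp : faithful_positive phiM) (phiN_fp : faithful_positive phiN).

Definition gns_hilbert : hilbertSpace R :=
  let gP := gns_ip phiM_fp in
  HilbertSpace (ip_linear gP) (ip_conj gP) (ip_ge0 gP) (ip_eq0 gP)
    (finite_dim_complete gP).

(** Stinespring without a quotient. On [L^2(N) (x) L^2(M)] let [T] be the positive
    operator whose form sends [(n (x) m, n' (x) m')] to
    [(m | theta (star n * n') m')], and let [S] be its square root. Both commute
    with the action of [N], so [v m = S (1 (x) m)] satisfies
    [(v z | y (v x)) = (1 (x) z | T (y (x) x)) = (z | theta y x)]. Hence the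
    Hilbert space [L] may be taken to be [L^2(M)]. *)
Lemma dilation_exists (theta : 'Hom(N, M)) : form_positive phiM theta ->
  exists v : {linear M -> l2tensor N gns_hilbert},
    is_dilation phiM phiN theta v.
Proof.
move=> th0; have gP := gns_ip phiM_fp.
pose E := {ffun 'I_(\dim {:N}) -> M} : vectType R[i].
pose ipE : E -> E -> R[i] := tensor_form (fun n m m' => phiN n * gns phiM m m').
have ipEP : inner_product ipE by exact: tensor_inner_product.
pose Fth (n : N) (m m' : M) := gns phiM m (theta n * m').
have Fth_lin m m' : scalar (fun n => Fth n m m').
  by move=> a x y; rewrite /Fth linearP mulrDl -scalerAl (ip_linear gP).
have Fth_sesq n : sesquilinear (Fth n).
  split=> x a y z; rewrite /Fth; first by rewrite mulrDr -scalerAr (ip_linear gP).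
  by rewrite (ipDl gP) (ipZl gP).
have Fip_lin m m' : scalar (fun n => phiN n * gns phiM m m').
  by move=> a x y; rewrite linearP mulrDl mulrA.
have Fip_sesq n : sesquilinear (fun m m' => phiN n * gns phiM m m').
  split=> x a y z; first by rewrite (ip_linear gP) mulrDr mulrCA.
  by rewrite (ipDl gP) (ipZl gP) mulrDr mulrCA.
have Bs := tensor_form_sesq Fth_sesq.
have [T TE] := sesq_operator (E := E) ipEP Bs.
have T0 t : 0 <= ipE t (T t) by rewrite -TE; exact: th0.
have [S [Ss SS SC]] := positive_sqrt ipEP T0.
have act_lfun y := @lfun_of_linear _ E E _ (tensor_mull_linear (V := M) y).
(* S inherits from T the invariance of the form under left multiplications *)
have S_mull y t : S (tensor_mull y t) = tensor_mull y (S t).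
  have [U UE] := act_lfun y.
  rewrite -!UE -[S (U t)]comp_lfunE -SC ?comp_lfunE //.
  apply/lfunP => u; rewrite !comp_lfunE !UE; apply: (ip_ext ipEP) => r.
  rewrite -TE -[y]starK -[LHS](tensor_form_mull Fip_lin Fip_sesq).
  by rewrite -[RHS]tensor_form_mull //; exact/esym/TE.
have [|iota iotaE] := @lfun_of_linear _ M E (tensor 1).
  by move=> a x y; apply/ffunP => i; rewrite !ffunE scalerDr !scalerA mulrC.
pose v : 'Hom(M, E) := (S \o iota)%VF.
have vE x : v x = S (iota x) by rewrite comp_lfunE.
have [w wE] := adjoint_exists gP v ipEP.
exists (v : {linear M -> l2tensor N gns_hilbert}).
exists (w : {linear l2tensor N gns_hilbert -> M}); split; first exact: wE.
move=> y x; apply: (ip_ext gP) => z; rewrite -wE.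
transitivity (ipE (v z) (tensor_mull y (v x))); last exact: erefl.
rewrite !vE -S_mull Ss -[S (S _)]comp_lfunE SS -TE !iotaE tensor_mull_tensor.
by rewrite tensor_form_tensor // star1 mul1r mulr1.
Qed.

End Dilations.

(** * The quantum relation as the range of a linear map *)
Lemma mem_vspace_functional (K : fieldType) (E : vectType K) (U : {vspace E}) x :
  (forall l : 'Hom(E, K^o), (forall u, u \in U -> l u = 0) -> l x = 0) -> x \in U.
Proof.
move=> H; pose f : 'End(E) := (\1 - projv U)%VF.
have fU u : u \in U -> f u = 0.
  by move=> uU; rewrite add_lfunE opp_lfunE id_lfunE projv_id // subrr.
suff /eqP : f x = 0.
  rewrite add_lfunE opp_lfunE id_lfunE subr_eq0 => /eqP->.
  exact: memv_proj.
rewrite [f x](coord_vbasis (memvf _)) big1 // => i _.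
have [|l lE] := @lfun_of_linear _ E K^o (fun y => coord (vbasis {:E}) i (f y)).
  by move=> a y z; rewrite !linearP.
rewrite -lE H ?scale0r // => u uU.
by rewrite lE fU // linear0.
Qed.

Section TensorOp.
Variables (R : realType) (M N : fdVNAlgType R).

Lemma tens_op_linearl (b : M) : linear (fun x : N => tens_op x b).
Proof.
by move=> a x y; apply/matrixP => i j; rewrite !mxE linearP mulrDl mulrA.
Qed.

Lemma tens_op_linearr (x : N) : linear (tens_op (M := M) x).
Proof.
by move=> a b c; apply/matrixP => i j; rewrite !mxE linearP mulrDr mulrCA.
Qed.

Lemma tensor_act_tens (x : N) (b : M) (T : 'Hom(M, N)) :
  tensor_act (tens_op x b) T = (amull x \o T \o amull b)%VF.
Proof.
apply/lfunP => z; rewrite sum_lfunE !comp_lfunE !amullE.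
rewrite [x in RHS](coord_vbasis (memvf _)) mulr_suml; apply: eq_bigr => i _.
rewrite sum_lfunE [b in RHS](coord_vbasis (memvf _)) mulr_suml linear_sum mulr_sumr.
apply: eq_bigr => j _; rewrite scale_lfunE mxE !comp_lfunE !amullE.
by rewrite -!scalerAl linearZ /= -scalerAr scalerA.
Qed.

Lemma tensor_act_linear (T : 'Hom(M, N)) : linear (tensor_act (M := M) (N := N) ^~ T).
Proof.
move=> a t u; rewrite scaler_sumr -big_split; apply: eq_bigr => i _ /=.
rewrite scaler_sumr -big_split; apply: eq_bigr => j _ /=.
by rewrite !mxE scalerDl scalerA.
Qed.

End TensorOp.

Section Relation.
Variables (R : realType) (M N : fdVNAlgType R).
Variables (phiM : {scalar M}) (phiN : {scalar N}).
Hypotheses (phiM_fp : faithful_positive phiM) (phiN_fp : faithful_positive phiN).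
Variable A : 'Hom(M, N).
Variable s : seq M.
Hypothesis sP : forall x, reproducing (gns phiM) s x.
Let gM := gns_ip phiM_fp.
Let gN := gns_ip phiN_fp.

Lemma rank_one_exists (x : N) (y : M) :
  exists T : 'Hom(M, N), forall z, T z = gns phiM y z *: x.
Proof.
apply: lfun_of_linear => a z w.
by rewrite (ip_linear gM) scalerDl scalerA.
Qed.

(** The map [psi'] exists: spread an operator over a frame of rank one operators,
    and use that [y] enters both sides antilinearly. *)
Lemma psi'_rank_one (x : N) (y : M) (T : 'Hom(M, N)) :
  (forall z, T z = gns phiM y z *: x) ->
  psi' N phiM T = tens_op x (star (modular_aut phiM ('i / 2) y)).
Proof.
pose c y := star (modular_aut phiM ('i / 2) y).
have cE z : c z = \sum_(e <- s) gns phiM z e *: c e.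
  rewrite {1}/c modular_autE // [in LHS](sP z) linear_sum star_sum.
  by apply: eq_bigr => e _; rewrite linearZ /= starZ -modular_autE // -(ip_conj gM).
have PP : exists P : 'Hom('Hom(M, N), tensor_op M N), forall x y (T : 'Hom(M, N)),
    (forall z, T z = gns phiM y z *: x) -> P T = tens_op x (c y).
  have [|P PE] := @lfun_of_linear _ _ _ (fun T : 'Hom(M, N) =>
      \sum_(e <- s) tens_op (T e) (c e)).
    move=> a U S; rewrite scaler_sumr -big_split; apply: eq_bigr => e _ /=.
    by rewrite add_lfunE scale_lfunE tens_op_linearl.
  exists P => u w S SE; rewrite PE [c w]cE.
  rewrite (linear_comb _ _ _ (tens_op_linearr u)); apply: eq_bigr => e _.
  apply/matrixP => i j.
  by rewrite SE !mxE linearZ /= mulrA.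
exact: (xgetPex 0 PP).
Qed.

(** This is [T] acted upon by [psi' A], followed by the square root of the modular
    operator of [N]; the right leg of [psi' A] is the modular twist of [star e]. *)
Definition nabla_half_op (T : 'Hom(M, N)) : 'Hom(M, N) :=
  (modular_pow phiN 2^-1 \o
    \sum_(e <- s) (amull (A e) \o T \o amull (modular_pow phiM 2^-1 (star e))))%VF.

Lemma psi'_frame :
  psi' N phiM A = \sum_(e <- s) tens_op (A e) (modular_pow phiM 2^-1 (star e)).
Proof.
pose r1 e := projT1 (cid (rank_one_exists (A e) e)).
have r1E e z : r1 e z = gns phiM e z *: A e by rewrite /r1; case: cid.
have AE : A = \sum_(e <- s) r1 e.
  apply/lfunP => z; rewrite sum_lfunE {1}(sP z) linear_sum.
  by apply: eq_bigr => e _; rewrite r1E linearZ.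
rewrite {1}AE linear_sum; apply: eq_bigr => e _; rewrite /= (psi'_rank_one (r1E e)).
by rewrite modular_autE // (modular_pow_star phiM_fp) (opprK 2^-1).
Qed.

Lemma tensor_act_psi' T : tensor_act (psi' N phiM A) T =
  \sum_(e <- s) (amull (A e) \o T \o amull (modular_pow phiM 2^-1 (star e)))%VF.
Proof.
rewrite psi'_frame -[X in tensor_act X](eq_bigr _ (fun e _ => scale1r _)).
rewrite (linear_comb _ _ _ (tensor_act_linear T)); apply: eq_bigr => e _.
by rewrite scale1r tensor_act_tens.
Qed.

(** The quarter powers combine: those on the left into a square root, those on the
    right into the identity. *)
Lemma quantum_relation_half :
  [set (modular_pow phiN 4^-1 \o T \o modular_pow phiM (- 4^-1))%VF
    | T in quantum_relation phiM phiN A] = range nabla_half_op.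
Proof.
have e4 : 4^-1 + 4^-1 = 2^-1 :> R by field.
have E T : (modular_pow phiN 4^-1 \o (modular_pow phiN 4^-1 \o
      tensor_act (psi' N phiM A) T \o modular_pow phiM 4^-1)
      \o modular_pow phiM (- 4^-1))%VF = nabla_half_op T.
  apply/lfunP => z; rewrite !comp_lfunE (modular_powD phiM_fp) subrr modular_pow0 //.
  by rewrite (modular_powD phiN_fp) e4 tensor_act_psi'.
apply/seteqP; split=> [_ [_ [_ [T _ <-] <-] <-]|_ [T _ <-]].
  by exists T => //; rewrite E.
exists (modular_pow phiN 4^-1 \o tensor_act (psi' N phiM A) T
  \o modular_pow phiM 4^-1)%VF; last exact: E.
by exists (tensor_act (psi' N phiM A) T) => //; exists T.
Qed.

Lemma nabla_half_opE T z : nabla_half_op T z =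
  \sum_(e <- s) modular_pow phiN 2^-1 (A e) *
    modular_pow phiN 2^-1 (T (modular_pow phiM 2^-1 (star e) * z)).
Proof.
rewrite comp_lfunE sum_lfunE linear_sum; apply: eq_bigr => e _.
by rewrite !comp_lfunE /= !amullE modular_powM.
Qed.

Local Notation theta := (kms_adjoint phiM phiN A).

(** The adjoint of [n |-> theta n * zeta], expanded in the frame. *)
Lemma adjoint_mulr_frame zeta n z :
  gns phiN n (\sum_(e <- s) gns phiM zeta (modular_pow phiM 2^-1 (star e) * z)
    *: modular_pow phiN 2^-1 (A e)) = gns phiM (theta n * zeta) z.
Proof.
pose y := op_adjoint phiM phiN A (modular_pow phiN 2^-1 n).
rewrite (ip_sumr gN) kms_adjointE -/y [y in RHS]sP linear_sum mulr_suml (ip_suml gM).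
apply: eq_bigr => e _; rewrite (ipZr gN) linearZ /= -scalerAl (ipZl gM) -(ip_conj gM).
rewrite -modular_pow_selfadjoint // (ip_conj gN) (op_adjointP phiM_fp phiN_fp).
rewrite -(ip_conj gM) mulrC.
by rewrite gns_mull (modular_pow_star phiM_fp) (opprK 2^-1).
Qed.

(** With [W zeta] the adjoint of [n |-> theta n * zeta], rank one operators are sent
    to the operators [W zeta] followed by right multiplications, that is, by
    elements of the commutant of [N]. *)
Lemma nabla_half_op_rank_one (W : M -> 'Hom(M, N)) (T : 'Hom(M, N)) eta zeta :
  (forall zeta z n, gns phiN n (W zeta z) = gns phiM (theta n * zeta) z) ->
  (forall z, T z = gns phiM zeta z *: eta) ->
  nabla_half_op T = (amulr (modular_pow phiN 2^-1 eta) \o W zeta)%VF.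
Proof.
move=> WE TE; apply/lfunP => z; rewrite nabla_half_opE comp_lfunE amulrE.
have -> : W zeta z = \sum_(e <- s) gns phiM zeta (modular_pow phiM 2^-1 (star e) * z)
    *: modular_pow phiN 2^-1 (A e).
  by apply: (ip_ext gN) => n; rewrite WE adjoint_mulr_frame.
rewrite mulr_suml; apply: eq_bigr => e _.
by rewrite TE linearZ /= -scalerAl -scalerAr.
Qed.

Lemma nabla_half_op_linear : linear nabla_half_op.
Proof.
move=> a T S; apply/lfunP => z; rewrite add_lfunE scale_lfunE !nabla_half_opE.
rewrite scaler_sumr -big_split; apply: eq_bigr => e _ /=.
by rewrite add_lfunE scale_lfunE linearP mulrDr scalerAr.
Qed.

Lemma nabla_half_op_decomp (W : M -> 'Hom(M, N)) T :
  (forall zeta z n, gns phiN n (W zeta z) = gns phiM (theta n * zeta) z) ->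
  nabla_half_op T =
    \sum_(f <- s) (amulr (modular_pow phiN 2^-1 (T f)) \o W f)%VF.
Proof.
move=> WE; pose r1 f := projT1 (cid (rank_one_exists (T f) f)).
have r1E f z : r1 f z = gns phiM f z *: T f by rewrite /r1; case: cid.
have -> : nabla_half_op T = nabla_half_op (\sum_(f <- s) 1 *: r1 f).
  congr nabla_half_op; apply/lfunP => z; rewrite sum_lfunE {1}(sP z) linear_sum.
  by apply: eq_bigr => e _; rewrite scale1r r1E linearZ.
rewrite (linear_comb _ _ _ nabla_half_op_linear); apply: eq_bigr => f _.
by rewrite scale1r (nabla_half_op_rank_one WE (r1E f)).
Qed.

End Relation.

(** * Kraus operators of a dilation *)
Section KrausFamily.
Variables (R : realType) (M N : fdVNAlgType R).
Variables (phiM : {scalar M}) (phiN : {scalar N}).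
Hypotheses (phiM_fp : faithful_positive phiM) (phiN_fp : faithful_positive phiN).
Variable L : hilbertSpace R.
Let gM := gns_ip phiM_fp.
Let gN := gns_ip phiN_fp.
Local Notation b := (vbasis {:N}).

Lemma hilbert_ip : inner_product (@hip R L).
Proof.
split; [exact: hip_linear | exact: hip_conj | exact: hip_ge0 | exact: hip_eq0].
Qed.

Lemma slice_linear xi : linear (l2tensor_slice (N := N) (L := L) xi).
Proof.
move=> a t u; rewrite scaler_sumr -big_split; apply: eq_bigr => j _ /=.
by rewrite !ffunE (ip_linear hilbert_ip) scalerDl scalerA.
Qed.

Lemma slice_act xi n (t : l2tensor N L) :
  l2tensor_slice xi (l2tensor_act n t) = n * l2tensor_slice xi t.
Proof.
rewrite /l2tensor_slice mulr_sumr.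
transitivity (\sum_(j < \dim {:N}) \sum_(l < \dim {:N})
    hip xi (t l) *: (coord b j (n * b`_l) *: b`_j)).
  apply: eq_bigr => j _; rewrite ffunE (ip_sumr hilbert_ip) scaler_suml.
  by apply: eq_bigr => l _; rewrite (ipZr hilbert_ip) mulrC scalerA.
rewrite exchange_big; apply: eq_bigr => l _ /=.
by rewrite -scaler_sumr -(coord_vbasis (memvf _)) scalerAr.
Qed.

Lemma l2tensor_ip_slice (es : seq L) (t u : l2tensor N L) :
  (forall i, reproducing (@hip R L) es (t i)) ->
  l2tensor_ip phiN t u =
  \sum_(e <- es) gns phiN (l2tensor_slice e t) (l2tensor_slice e u).
Proof.
move=> tP.
under [RHS]eq_bigr => e _ do rewrite (ip_suml gN).
rewrite [RHS]exchange_big; apply: eq_bigr => i _ /=.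
under [RHS]eq_bigr => e _ do rewrite (ip_sumr gN).
rewrite [RHS]exchange_big; apply: eq_bigr => j _ /=.
rewrite (reproducing_ip hilbert_ip _ (tP i)) mulr_sumr; apply: eq_bigr => e _.
by rewrite (ipZl gN) (ipZr gN) -(hip_conj e) mulrA mulrC mulrA mulrC.
Qed.

(** Only finitely many vectors of [L] occur as coordinates of the vectors [v x]. A
    frame [es] for them turns the dilation into a finite Kraus decomposition, with
    [K e] the slice of [v] along [e], and every other slice is a combination of
    these. *)
Lemma kraus_family (theta : 'Hom(N, M)) (v : {linear M -> l2tensor N L}) :
  is_dilation phiM phiN theta v ->
  exists (es : seq L) (K : L -> 'Hom(M, N)),
  [/\ forall xi x, K xi x = l2tensor_slice xi (v x),
      forall xi, K xi = \sum_(e <- es) hip xi e *: K e &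
      forall n z zeta, gns phiM z (theta n * zeta) =
        \sum_(e <- es) gns phiN (K e z) (n * K e zeta)].
Proof.
move=> [w [wE thE]].
have [es esP] := gram_schmidt hilbert_ip
  [seq v (vbasis {:M})`_(val k) j | k : 'I_(\dim {:M}) <- enum 'I_(\dim {:M}),
                             j : 'I_(\dim {:N}) <- enum 'I_(\dim {:N})].
have vP x j : reproducing (@hip R L) es (v x j).
  rewrite /reproducing [x](coord_vbasis (memvf _)) linear_sum sum_ffunE.
  under [RHS]eq_bigr => e _ do rewrite (ip_sumr hilbert_ip) scaler_suml.
  rewrite [RHS]exchange_big; apply: eq_bigr => k _ /=.
  rewrite linearZ ffunE.
  under [RHS]eq_bigr => e _ do rewrite (ipZr hilbert_ip) -scalerA.
  rewrite -scaler_sumr; congr (_ *: _); apply: esP; rewrite mem_cat.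
  by apply/orP; left; apply/allpairsP; exists (k, j); rewrite !mem_enum.
have KP xi : exists Kx : 'Hom(M, N), forall x, Kx x = l2tensor_slice xi (v x).
  apply: lfun_of_linear => a x y.
  by rewrite linearP slice_linear.
have [K KE] := choice KP.
exists es, K; split=> //.
  move=> xi; apply/lfunP => x; rewrite sum_lfunE KE.
  under [RHS]eq_bigr => e _ do rewrite scale_lfunE KE scaler_sumr.
  rewrite [RHS]exchange_big; apply: eq_bigr => j _ /=.
  under [RHS]eq_bigr => e _ do rewrite scalerA.
  by rewrite -scaler_suml -(reproducing_ipr hilbert_ip _ (vP _ _)).
move=> n z zeta; rewrite thE -wE (l2tensor_ip_slice _ (vP z)).
by apply: eq_bigr => e _; rewrite slice_act !KE.
Qed.

End KrausFamily.

(** * Comparison of the two relations *)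
Lemma commutant_amulr (R : realType) (M : fdVNAlgType R) (x : M) : commutant (amulr x).
Proof. by move=> a; apply/lfunP => y; rewrite !comp_lfunE !amullE !amulrE mulrA. Qed.

Lemma commutantE (R : realType) (M : fdVNAlgType R) (T : 'End(M)) :
  commutant T -> T = amulr (T 1).
Proof.
move=> Tc; apply/lfunP => y; rewrite amulrE -amullE.
by have := congr1 (fun S : 'End(M) => S 1) (Tc y);
   rewrite !comp_lfunE [amull y 1]amullE mulr1.
Qed.

Section ModularTrace.
Variables (R : realType) (M : fdVNAlgType R).
Variables (phi : {scalar M}) (phi_fp : faithful_positive phi).

Lemma tr_modular s x : markov_trace (modular_pow phi s x) = markov_trace x.
Proof. by rewrite modular_powE // trC mulrA dpowD // addNr dpow0 // mul1r. Qed.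

(** The adjoint of right multiplication by [y] is right multiplication by
    [sharp y]. *)
Definition sharp (x : M) : M := modular_pow phi 1 (star x).

Lemma sharpK x : sharp (sharp x) = x.
Proof. by rewrite /sharp modular_pow_star // starK modular_powD // subrr modular_pow0. Qed.

Lemma sharpM x y : sharp (x * y) = sharp y * sharp x.
Proof. by rewrite /sharp starM modular_powM. Qed.

Lemma sharp0 : sharp 0 = 0.
Proof. by rewrite /sharp star0 linear0. Qed.

Lemma sharp_sum (I : Type) (r : seq I) (F : I -> M) :
  sharp (\sum_(i <- r) F i) = \sum_(i <- r) sharp (F i).
Proof. by rewrite /sharp star_sum linear_sum. Qed.

(** The trace is invariant under the modular group, so the modular twist in
    [sharp x] may be shared evenly between the two factors. *)
Lemma tr_sharp x : markov_trace (x * sharp x) =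
  tr_form (modular_pow phi 2^-1 (star x)) (modular_pow phi 2^-1 (star x)).
Proof.
rewrite /tr_form (modular_pow_star phi_fp) starK -[LHS](tr_modular (- 2^-1)).
rewrite (modular_powM phi_fp).
by rewrite /sharp (modular_powD phi_fp) [X in - _ + X]splitr mul1r addKr.
Qed.

Lemma gns_sharp x y z : gns phi (x * y) z = gns phi x (z * sharp y).
Proof. by rewrite /gns starM mulrA (phi_modular phi_fp) mulrA. Qed.

End ModularTrace.

Section DilationRelation.
Variables (R : realType) (M N : fdVNAlgType R).
Variables (phiM : {scalar M}) (phiN : {scalar N}).
Hypotheses (phiM_fp : faithful_positive phiM) (phiN_fp : faithful_positive phiN).
Let gM := gns_ip phiM_fp.
Let gN := gns_ip phiN_fp.

Variables (I : eqType) (es : seq I) (K : I -> 'Hom(M, N)) (theta : 'Hom(N, M)).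
Hypothesis KE : forall n z zeta, gns phiM z (theta n * zeta) =
  \sum_(e <- es) gns phiN (K e z) (n * K e zeta).
Variable W : M -> 'Hom(M, N).
Hypothesis WE : forall zeta z n, gns phiN n (W zeta z) = gns phiM (theta n * zeta) z.

Lemma kraus_adjoint zeta :
  W zeta = \sum_(e <- es) (amulr (sharp phiN (K e zeta)) \o K e)%VF.
Proof.
apply/lfunP => z; apply: (ip_ext gN) => n.
rewrite WE (ip_conj gM) KE rmorph_sum sum_lfunE (ip_sumr gN).
apply: eq_bigr => e _ /=; rewrite -(ip_conj gN) comp_lfunE amulrE.
by rewrite gns_sharp.
Qed.

(** The crux. Write [l (amulr n \o K e)] as the trace of [h e * n]. Vanishing on
    the operators [amulr n \o W zeta] says that the sum of the
    [h e * sharp (K e zeta)] is zero for all [zeta]. Since [sharp] is an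
    anti-multiplicative involution, the operators [K e] then satisfy the linear
    relation with coefficients [amulr (sharp (h e))]; applying [l] to this relation
    gives a vanishing sum of the nonnegative traces of [h e * sharp (h e)], so that
    every [h e] is zero. *)
Lemma kraus_functional_zero (l : 'Hom('Hom(M, N), R[i]^o)) :
  (forall n zeta, l (amulr n \o W zeta)%VF = 0) ->
  {in es, forall e n, l (amulr n \o K e)%VF = 0}.
Proof.
move=> lW.
have comp_lin e : linear (fun n : N => (amulr n \o K e)%VF).
  move=> a x y; apply/lfunP => z.
  by rewrite add_lfunE scale_lfunE !comp_lfunE !amulrE mulrDr scalerAr.
have hP e : exists he, forall n, l (amulr n \o K e)%VF = markov_trace (he * n).
  apply: (tr_riesz phiN_fp (f := fun n => l (amulr n \o K e)%VF)) => a x y.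
  by rewrite comp_lin linearP.
have [h hE] := choice hP.
have hK zeta : \sum_(e <- es) h e * sharp phiN (K e zeta) = 0.
  apply: (tr_nondeg phiN_fp) => n; rewrite mul0r.
  transitivity (l (amulr n \o W zeta)%VF); last first.
    by rewrite lW tr0.
  have -> : (amulr n \o W zeta)%VF =
      \sum_(e <- es) (amulr (sharp phiN (K e zeta) * n) \o K e)%VF.
    apply/lfunP => z; rewrite comp_lfunE amulrE kraus_adjoint !sum_lfunE mulr_suml.
    by apply: eq_bigr => e _; rewrite !comp_lfunE !amulrE mulrA.
  rewrite linear_sum mulr_suml tr_sum.
  by apply: eq_bigr => e _ /=; rewrite hE mulrA.
have Kh : \sum_(e <- es) (amulr (sharp phiN (h e)) \o K e)%VF = 0.
  apply/lfunP => zeta; rewrite sum_lfunE zero_lfunE.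
  have := congr1 (sharp phiN) (hK zeta).
  rewrite sharp_sum sharp0 => e0; rewrite -[RHS]e0.
  by apply: eq_bigr => e _; rewrite comp_lfunE amulrE sharpM // sharpK.
have : \sum_(e <- es) markov_trace (h e * sharp phiN (h e)) = 0.
  have := congr1 l Kh; rewrite linear0 linear_sum => e0; rewrite -[RHS]e0.
  by apply: eq_bigr => e _; rewrite /= hE.
have tr_ge0 e : 0 <= markov_trace (h e * sharp phiN (h e)).
  by rewrite tr_sharp //; exact: (ip_ge0 (tr_ip phiN_fp)).
move/eqP; rewrite psumr_eq0 // => /allP z e /z /eqP.
rewrite tr_sharp // => /(ip_eq0 (tr_ip phiN_fp)) h0 n.
have he0 : h e = 0.
  rewrite -[h e]starK -[star (h e)](modular_pow0 phiN_fp) -(addNr 2^-1).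
  by rewrite -modular_powD // h0 linear0 star0.
by rewrite hE he0 mul0r tr0.
Qed.

End DilationRelation.

(** Both sides are the span of the operators [amulr n \o W zeta], where [W zeta] is
    the adjoint of [n |-> theta n * zeta]. *)
Lemma dilation_relation_half (R : realType) (M N : fdVNAlgType R)
    (phiM : {scalar M}) (phiN : {scalar N})
    (phiM_fp : faithful_positive phiM) (phiN_fp : faithful_positive phiN)
    (A : 'Hom(M, N)) (s : seq M) (L : hilbertSpace R)
    (v : {linear M -> l2tensor N L}) :
  (forall x, reproducing (gns phiM) s x) ->
  is_dilation phiM phiN (kms_adjoint phiM phiN A) v ->
  dilation_relation v = range (nabla_half_op phiM phiN A s).
Proof.
move=> sP /(kraus_family phiN_fp)[es [K [KE Kspan Kdil]]].
set theta := kms_adjoint phiM phiN A in Kdil.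
have gM := gns_ip phiM_fp; have gN := gns_ip phiN_fp.
have WP zeta : exists Wz : 'Hom(M, N), forall z n,
    gns phiN n (Wz z) = gns phiM (theta n * zeta) z.
  have [|F FE] := @lfun_of_linear _ N M (fun n => theta n * zeta).
    by move=> a x y; rewrite linearP mulrDl -scalerAl.
  have [Wz WzE] := adjoint_exists gN F gM.
  by exists Wz => z n; rewrite -WzE FE.
have [W WE] := choice WP.
have [H HE] := lfun_of_linear (nabla_half_op_linear phiM phiN_fp A s).
have gen c xi : exists2 y' : 'End(N), commutant y' &
    exists xi' : L, forall x, (amulr c \o K xi)%VF x = y' (l2tensor_slice xi' (v x)).
  exists (amulr c); first exact: commutant_amulr.
  by exists xi => x; rewrite comp_lfunE KE.
apply/seteqP; split=> [T Tspan|_ [T _ <-] U genU].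
(* a slice operator that every functional vanishing on the range kills is in it *)
- suff : T \in limg H by move=> /memv_imgP[S _ ->]; exists S => //; rewrite HE.
  apply: Tspan => S [y' y'C [xi SE]] /=.
  have -> : S = \sum_(e <- es) hip xi e *: (amulr (y' 1) \o K e)%VF.
    apply/lfunP => x; rewrite SE -KE Kspan !sum_lfunE linear_sum.
    apply: eq_bigr => e _; rewrite !scale_lfunE linearZ comp_lfunE /=.
    by rewrite {1}(commutantE y'C).
  rewrite big_seq; apply: memv_suml => e ees; apply: memvZ.
  apply: mem_vspace_functional => l lU.
  apply: (kraus_functional_zero phiM_fp phiN_fp Kdil WE _ ees) => n zeta.
  apply: lU; apply/memv_imgP.
  have [T0 T0E] := rank_one_exists phiM_fp (modular_pow phiN (- 2^-1) n) zeta.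
  exists T0; first exact: memvf.
  rewrite HE (nabla_half_op_rank_one phiM_fp phiN_fp sP WE T0E).
  by rewrite modular_powD // subrr modular_pow0.
(* conversely, the frame splits T into rank one operators, each of which gives a
   combination of slice operators followed by elements of the commutant *)
rewrite (nabla_half_op_decomp phiM_fp phiN_fp sP _ WE).
apply: memv_suml => f _; rewrite (kraus_adjoint phiM_fp phiN_fp Kdil WE).
set c := modular_pow _ _ _.
have -> : (amulr c \o \sum_(e <- es) (amulr (sharp phiN (K e f)) \o K e))%VF =
    \sum_(e <- es) (amulr (sharp phiN (K e f) * c) \o K e)%VF.
  apply/lfunP => z; rewrite comp_lfunE amulrE !sum_lfunE mulr_suml.
  by apply: eq_bigr => e _; rewrite !comp_lfunE !amulrE mulrA.
by apply: memv_suml => e _; apply: genU; exact: gen.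
Qed.

Theorem proposition5p11 (R : realType) (M N : fdVNAlgType R)
    (phiM : {scalar M}) (phiN : {scalar N})
    (phiM_fp : faithful_positive phiM) (phiN_fp : faithful_positive phiN)
    (A : 'Hom(M, N)) (A_cp : completely_positive A) :
  let V := quantum_relation phiM phiN A in
  let theta := kms_adjoint phiM phiN A in
  [/\ completely_positive theta,
      exists (L : hilbertSpace R) (v : {linear M -> l2tensor N L}),
        is_dilation phiM phiN theta v &
      forall (L : hilbertSpace R) (v : {linear M -> l2tensor N L}),
        is_dilation phiM phiN theta v ->
        dilation_relation v =
          [set (modular_pow phiN 4^-1 \o T \o modular_pow phiM (- 4^-1))%VF
            | T in V] /\
        (tracial phiM -> tracial phiN -> dilation_relation v = V)].
Proof.
move=> V theta.
have theta_pos : form_positive phiM theta.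
  exact: kms_adjoint_form_positive A_cp.
have [s sP] := finite_frame (gns_ip phiM_fp).
split.
- exact: (form_positive_cp phiM_fp theta_pos).
- exists (gns_hilbert phiM_fp); exact: dilation_exists theta_pos.
move=> L v dil.
have relE : dilation_relation v =
    [set (modular_pow phiN 4^-1 \o T \o modular_pow phiM (- 4^-1))%VF | T in V].
  rewrite (quantum_relation_half phiM_fp phiN_fp A sP).
  exact: dilation_relation_half dil.
split; first exact: relE.
move=> traM traN; rewrite relE.
rewrite (tracial_modular_pow phiN_fp _ traN) (tracial_modular_pow phiM_fp _ traM).
have -> : (fun T : 'Hom(M, N) => (\1 \o T \o \1)%VF) = id.
  by apply/funext => T; rewrite comp_lfun1l comp_lfun1r.
exact: image_id.
Qed.
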